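(* Let $\mu$ be a partition of $m$, let $\nu$ be a partition of $n$, and let $\lambda$ be a partition of $mn$. Set $\kappa=\nu'$ if $m$ is even, and $\kappa=\nu$ if $m$ is odd. Let $q$ be the number of conjugate-semistandard tableau family tuples of shape $\mu^\kappa$ and type $\lambda$. Then $$\dim \operatorname{Hom}_{\mathbb{Q}S_{mn}}\bigl(S^\lambda,\ (S^\mu\oslash S^\nu)\uparrow_{S_m\wr S_n}^{S_{mn}}\bigr)\le q.$$
   Context: Here $m,n$ are positive integers and $\mathbb{N}=\{1,2,\ldots\}$. For a partition $\gamma$, $\gamma'$ denotes its conjugate. $S^\lambda$ is the Specht module over $\mathbb{Q}$ for the symmetric group, labelled by $\lambda$ (irreducible, with $S^{(r)}$ the trivial $\mathbb{Q}S_r$-module). The wreath product $S_m\wr S_n$ acts as a transitive imprimitive subgroup of $S_{mn}$. For a $\mathbb{Q}S_m$-module $W$ and a $\mathbb{Q}S_n$-module $Z$, $W\oslash Z$ is the $\mathbb{Q}(S_m\wr S_n)$-module $W^{\otimes n}\otimes Z$, where $S_m^n$ acts factorwise on $W^{\otimes n}$ and trivially on $Z$, and $S_n$ acts by permuting the tensor factors of $W^{\otimes n}$ (no signs) and by its given action on $Z$. A tableau with entries in $\mathbb{N}$ is conjugate-semistandard if its rows are strictly increasing (left to right) and its columns are weakly increasing (top to bottom). A conjugate-semistandard tableau family of shape $\mu^d$ is a set of $d$ (distinct) conjugate-semistandard $\mu$-tableaux. If $\kappa$ is a partition of $n$ with exactly $c$ parts, a conjugate-semistandard tableau family tuple of shape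 $\mu^\kappa$ is a tuple $(\mathcal{T}_1,\ldots,\mathcal{T}_c)$ where each $\mathcal{T}_i$ is a conjugate-semistandard tableau family of shape $\mu^{\kappa_i}$. Its weight is the composition $(\gamma_1,\ldots,\gamma_M)$, where $M$ is the greatest entry of the tableaux in $\mathcal{T}_1,\ldots,\mathcal{T}_c$ and $\gamma_j$ is the total number of occurrences of $j$ in the tableaux in the families. If the weight $\gamma$ is a partition, the type of the tuple is the conjugate partition $\gamma'$. *)

(* Defs.v *)
From mathcomp Require Import boolp classical_sets cardinality.
From mathcomp Require Import finmap.
From mathcomp Require Import all_boot all_order all_algebra all_fingroup.
From mathcomp Require Import mxrepresentation.

Set Implicit Arguments.
Unset Strict Implicit.
Unset Printing Implicit Defensive.

Import GroupScope GRing.Theory.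
Local Open Scope ring_scope.

(* Modules are MathComp matrix representations: a group element acts on row   *)
(* vectors by right multiplication, and (s * t) x = t (s x) for permutations. *)
(* So everything below is a right module; composing with g |-> g^-1 turns it  *)
(* into the usual left module without changing isomorphism types or Homs.     *)

Section FinMatrix.

Variables (F : fieldType) (I : finType).

Definition fin_mx (E : I -> I -> F) : 'M[F]_#|I| :=
  \matrix_(i, j) E (enum_val i) (enum_val j).

Lemma fin_mx1 (E : I -> I -> F) :
  (forall x y, E x y = (x == y)%:R) -> fin_mx E = 1%:M.
Proof. by move=> EE; apply/matrixP=> i j; rewrite !mxE EE (inj_eq enum_val_inj). Qed.

Lemma fin_mxM (E1 E2 E : I -> I -> F) :
  (forall x y, E x y = \sum_z E1 x z * E2 z y) ->
  fin_mx E = fin_mx E1 *m fin_mx E2.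
Proof.
move=> EE; apply/matrixP=> i j; rewrite !mxE EE (reindex _ (onW_bij _ (enum_val_bij I))).
by apply: eq_bigr => k _; rewrite !mxE.
Qed.

End FinMatrix.

Section Hom.

Variables (F : fieldType) (gT : finGroupType) (G : {group gT}) (d e : nat).
Variables (rV : mx_representation F G d) (rW : mx_representation F G e).

(* A : 'M_(d, e) encodes the linear map v |-> v *m A from V to W.             *)
Definition hom_space : {vspace 'M[F]_(d, e)} :=
  (\bigcap_(g in G) lker (linfun (mulmx (rV g) \- mulmxr (rW g))%R))%VS.

Lemma hom_spaceP A :
  reflect (forall g, g \in G -> rV g *m A = A *m rW g) (A \in hom_space).
Proof.
rewrite memvE; apply: (iffP subv_bigcapP) => [homA g Gg | homA g Gg].
  have := homA g Gg; rewrite -memvE memv_ker lfunE /= subr_eq0.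
  by move/eqP.
by rewrite -memvE memv_ker lfunE /= subr_eq0 homA.
Qed.

End Hom.

Section Induction.

Variables (F : fieldType) (gT : finGroupType) (H : {group gT}) (d : nat).
Variable rH : mx_representation F H d.

Definition right_coset := {C : {set gT} | C \in rcosets H [set: gT]}.

Definition coset_rep (C : right_coset) : gT := repr (val C).

(* V (x)_{FH} FG has basis v_i (x) x, with x running over the representatives *)
(* of the right cosets of H, and (v (x) x) g = v (x g y^-1) (x) y, where y is *)
(* the representative of H x g.                                               *)
Definition ind_coef (g : gT) (p q : right_coset * 'I_d) : F :=
  let h := (coset_rep p.1 * g * (coset_rep q.1)^-1)%g in
  if h \in H then rH h p.2 q.2 else 0.

Definition ind_mx (g : gT) : 'M[F]_#|{: right_coset * 'I_d}| :=
  fin_mx (ind_coef g).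

Lemma val_right_coset (C : right_coset) : val C = (H :* coset_rep C)%g.
Proof.
case: C => C /= CH; rewrite /coset_rep /=; case/rcosetsP: (CH) => x _ ->.
by rewrite rcoset_repr.
Qed.

Lemma right_coset_eq (C D : right_coset) :
  (C == D) = (coset_rep C * (coset_rep D)^-1 \in H)%g.
Proof.
by rewrite -val_eqE /= !val_right_coset -mem_rcoset (sameP eqP rcoset_eqP).
Qed.

Lemma right_coset_exists x :
  exists C : right_coset, (x * (coset_rep C)^-1 \in H)%g.
Proof.
have HxP : (H :* x)%g \in rcosets H [set: gT] by apply/rcosetsP; exists x.
exists (Sub (H :* x)%g HxP); rewrite -mem_rcoset -val_right_coset /=.
exact: rcoset_refl.
Qed.

Lemma ind_mx_repr : mx_repr [set: gT] ind_mx.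
Proof.
split=> [|x y _ _].
  apply: fin_mx1 => -[C i] [D j]; rewrite /ind_coef /= mulg1 -right_coset_eq.
  rewrite xpair_eqE; case: eqP => [<- | //] /=.
  by rewrite mulgV repr_mx1 mxE.
apply: fin_mxM => -[C i] [D j]; rewrite /ind_coef /=.
have [B CB] := right_coset_exists (coset_rep C * x)%g.
rewrite (eq_bigr (fun p : right_coset * 'I_d => ind_coef x (C, i) (p.1, p.2)
                   * ind_coef y (p.1, p.2) (D, j))); last by case.
rewrite -(pair_bigA _ (fun K k => ind_coef x (C, i) (K, k) * ind_coef y (K, k) (D, j))) /=.
rewrite (bigD1 B) //= [X in _ + X]big1 ?addr0 => [|K neqKB]; last first.
  rewrite big1 // => k _; rewrite /ind_coef /=; case: ifP => [CK|_]; last by rewrite mul0r.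
  case/eqP: neqKB; apply/eqP; rewrite right_coset_eq.
  have := groupM (groupVr CK) CB.
  by rewrite !invMg invgK -!mulgA mulKg mulKg.
rewrite /ind_coef /= CB.
have -> : (coset_rep C * (x * y) * (coset_rep D)^-1)%g =
  (coset_rep C * x * (coset_rep B)^-1 * (coset_rep B * y * (coset_rep D)^-1))%g.
  by rewrite !mulgA mulgKV.
rewrite groupMl //; case: ifP => [BD | _]; last by rewrite big1 // => k _; rewrite mulr0.
by rewrite repr_mxM // mxE.
Qed.

Definition ind_repr : mx_representation F [set: gT] #|{: right_coset * 'I_d}| :=
  MxRepresentation ind_mx_repr.

End Induction.

Section Wreath.

Variables (m n : nat) (m_gt0 : (0 < m)%N).

(* 'I_(m * n) is split into n blocks of size m: mxvec_index a i is the a-th   *)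
(* element of block i.                                                        *)
Definition block_offset (x : 'I_(m * n)) : 'I_m * 'I_n :=
  enum_val (cast_ord (esym (mxvec_cast m n)) x).
Definition block (x : 'I_(m * n)) : 'I_n := (block_offset x).2.
Definition offset (x : 'I_(m * n)) : 'I_m := (block_offset x).1.

Definition wreath_set : {set 'S_(m * n)} :=
  [set s : 'S_(m * n) |
    [forall x, forall y, (block x == block y) ==> (block (s x) == block (s y))]].

(* For s in the wreath product, s maps mxvec_index a i to                     *)
(* mxvec_index (base_perm s i a) (top_perm s i), see wreathE.                 *)
Definition top_perm (s : 'S_(m * n)) : 'S_n :=
  insubd (1%g : 'S_n) [ffun i => block (s (mxvec_index (Ordinal m_gt0) i))].
Definition base_perm (s : 'S_(m * n)) (i : 'I_n) : 'S_m :=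
  insubd (1%g : 'S_m) [ffun a => offset (s (mxvec_index a i))].

Lemma block_offsetK a i : block_offset (mxvec_index a i) = (a, i).
Proof. by rewrite /block_offset /mxvec_index cast_ordK enum_rankK. Qed.

Lemma blockE a i : block (mxvec_index a i) = i.
Proof. by rewrite /block block_offsetK. Qed.

Lemma offsetE a i : offset (mxvec_index a i) = a.
Proof. by rewrite /offset block_offsetK. Qed.

Lemma mxvec_indexK x : mxvec_index (offset x) (block x) = x.
Proof. by case/mxvec_indexP: x => a i; rewrite blockE offsetE. Qed.

Lemma wreathP (s : 'S_(m * n)) :
  reflect (forall x y, block x = block y -> block (s x) = block (s y)) (s \in wreath_set).
Proof.
rewrite inE; apply: (iffP forallP) => [ws x y exy | ws x].
  by have /forallP/(_ y)/implyP := ws x; rewrite exy eqxx => /(_ isT)/eqP.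
by apply/forallP=> y; apply/implyP=> /eqP exy; apply/eqP/ws.
Qed.

Lemma wreath_group_set : group_set wreath_set.
Proof.
apply/group_setP; split=> [|s t /wreathP ws /wreathP wt].
  by apply/wreathP=> x y; rewrite !perm1.
by apply/wreathP=> x y exy; rewrite !permM; apply/wt/ws.
Qed.
Canonical wreath_group := Group wreath_group_set.

Lemma top_permE (s : 'S_(m * n)) x : s \in wreath_set -> top_perm s (block x) = block (s x).
Proof.
move=> /wreathP ws; rewrite /top_perm -pvalE.
set f := [ffun i => _].
have fE y : f (block y) = block (s y) by rewrite ffunE; apply: ws; rewrite blockE.
suff inj_f : injectiveb f by rewrite insubdK.
have f_onto : codom f =i 'I_n.
  move=> j; rewrite inE; apply/codomP.
  exists (block ((s^-1)%g (mxvec_index (Ordinal m_gt0) j))).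
  by rewrite fE permKV blockE.
by apply/card_uniqP; rewrite (eq_card f_onto) size_map -cardE.
Qed.

Lemma base_permE (s : 'S_(m * n)) x : s \in wreath_set -> base_perm s (block x) (offset x) = offset (s x).
Proof.
move=> ws; rewrite /base_perm -pvalE.
set f := [ffun a => _].
suff inj_f : injectiveb f by rewrite insubdK //= /f ffunE mxvec_indexK.
apply/injectiveP=> a b; rewrite !ffunE => eq_off.
have eq_blk: block (s (mxvec_index a (block x))) = block (s (mxvec_index b (block x))).
  by apply: (wreathP _ ws); rewrite !blockE.
have: s (mxvec_index a (block x)) = s (mxvec_index b (block x)).
  by rewrite -[LHS]mxvec_indexK -[RHS]mxvec_indexK eq_off eq_blk.
by move/perm_inj/(congr1 offset); rewrite !offsetE.
Qed.

Lemma wreathE (s : 'S_(m * n)) a i : s \in wreath_set ->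
  s (mxvec_index a i) = mxvec_index (base_perm s i a) (top_perm s i).
Proof.
move=> ws; rewrite -[LHS]mxvec_indexK -(top_permE _ ws) -(base_permE _ ws).
by rewrite blockE offsetE.
Qed.

Lemma top_perm1 : top_perm 1 = 1%g.
Proof.
apply/permP=> i; rewrite -[i](blockE (Ordinal m_gt0)).
by rewrite top_permE ?group1 // !perm1.
Qed.

Lemma base_perm1 i : base_perm 1 i = 1%g.
Proof.
apply/permP=> a; rewrite -[a](offsetE _ i) -{1}[i](blockE a).
by rewrite base_permE ?group1 // !perm1.
Qed.

Lemma top_permM (s t : 'S_(m * n)) : s \in wreath_set -> t \in wreath_set ->
  top_perm (s * t) = (top_perm s * top_perm t)%g.
Proof.
move=> ws wt; apply/permP=> i; rewrite -[i](blockE (Ordinal m_gt0)) permM.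
by rewrite !top_permE ?groupM // permM.
Qed.

Lemma base_permM (s t : 'S_(m * n)) i : s \in wreath_set -> t \in wreath_set ->
  base_perm (s * t) i = (base_perm s i * base_perm t (top_perm s i))%g.
Proof.
move=> ws wt; apply/permP=> a; rewrite permM.
have := wreathE a i (groupM ws wt); rewrite permM !wreathE //.
by move/(congr1 offset); rewrite !offsetE.
Qed.

Variables (F : fieldType) (d e : nat).
Variables (rW : mx_representation F [set: 'S_m] d).
Variables (rZ : mx_representation F [set: 'S_n] e).

(* W^{(x) n} (x) Z has basis w_{f 0} (x) ... (x) w_{f (n-1)} (x) z_k, for     *)
(* f : {ffun 'I_n -> 'I_d} and k : 'I_e.  The i-th tensor factor is acted on  *)
(* by base_perm s i and then moved to position top_perm s i.                  *)
Definition oslash_coef (s : 'S_(m * n)) (p q : {ffun 'I_n -> 'I_d} * 'I_e) : F :=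
  (\prod_i rW (base_perm s i) (p.1 i) (q.1 (top_perm s i)))
    * rZ (top_perm s) p.2 q.2.

Definition oslash_mx (s : 'S_(m * n)) :
    'M[F]_#|{: {ffun 'I_n -> 'I_d} * 'I_e}| :=
  fin_mx (oslash_coef s).

Lemma oslash_mx_repr : mx_repr wreath_set oslash_mx.
Proof.
split=> [|s t ws wt].
  apply: fin_mx1 => -[f k] [g l]; rewrite /oslash_coef /= top_perm1 repr_mx1 mxE.
  rewrite (eq_bigr (fun i => (f i == g i)%:R : F)) => [|i _]; last first.
    by rewrite base_perm1 perm1 repr_mx1 mxE.
  rewrite xpair_eqE -natr_prod -natrM; congr (_%:R).
  have [<- | neq_fg] := eqVneq f g; first by rewrite big1 => [|i _]; rewrite ?mul1n ?eqxx.
  have [i neq_i] : exists i, f i != g i.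
    apply/existsP; rewrite -negb_forall; apply: contra neq_fg => /forallP fg.
    by apply/eqP/ffunP=> i; apply/eqP.
  by rewrite (bigD1 i) //= (negPf neq_i).
apply: fin_mxM => -[f k] [g l]; rewrite /oslash_coef /=.
rewrite (eq_bigr (fun p : {ffun 'I_n -> 'I_d} * 'I_e =>
    ((\prod_i rW (base_perm s i) (f i) (p.1 (top_perm s i))) *
     (\prod_i rW (base_perm t i) (p.1 i) (g (top_perm t i)))) *
    (rZ (top_perm s) k p.2 * rZ (top_perm t) p.2 l))); last first.
  by case=> h j _ /=; rewrite mulrACA.
rewrite -(pair_bigA _ (fun (h : {ffun 'I_n -> 'I_d}) j =>
    ((\prod_i rW (base_perm s i) (f i) (h (top_perm s i))) *
     (\prod_i rW (base_perm t i) (h i) (g (top_perm t i)))) *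
    (rZ (top_perm s) k j * rZ (top_perm t) j l))) /=.
under [RHS]eq_bigr do rewrite -mulr_sumr.
rewrite -[RHS]mulr_suml top_permM // repr_mxM ?inE // mxE; congr (_ * _).
transitivity (\prod_j \sum_a
    rW (base_perm s ((top_perm s)^-1 j)%g) (f ((top_perm s)^-1 j)%g) a *
    rW (base_perm t j) a (g (top_perm t j))).
  rewrite [RHS](reindex_inj (@perm_inj _ (top_perm s))) /=; apply: eq_bigr => i _.
  by rewrite base_permM // repr_mxM ?inE // mxE permM permK.
rewrite bigA_distr_bigA /=; apply: eq_bigr => h _; rewrite big_split /=.
congr (_ * _); rewrite (reindex_inj (@perm_inj _ (top_perm s))) /=.
by apply: eq_bigr => i _; rewrite permK.
Qed.

Definition oslash :
    mx_representation F wreath_group #|{: {ffun 'I_n -> 'I_d} * 'I_e}| :=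
  MxRepresentation oslash_mx_repr.

End Wreath.

Section Partitions.

Definition is_partition (r : nat) (lambda : seq nat) : bool :=
  [&& sorted geq lambda, all (ltn 0) lambda & sumn lambda == r].

Definition conj_part (lambda : seq nat) : seq nat :=
  mkseq (fun j => count (ltn j) lambda) (head 0%N lambda).

End Partitions.

Section Specht.

(* Cells of the diagram of lambda, a partition of r, are numbered             *)
(* 0, ..., r - 1 along successive rows, so cell k lies in row                 *)
(* reshape_index lambda k and column reshape_offset lambda k.  A tableau is a *)
(* permutation t of 'I_r, cell k having entry t k; S_r acts by t |-> t * g.   *)
Variables (r : nat) (lambda : seq nat).

Definition row_place_perms : {set 'S_r} :=
  [set p : 'S_r | [forall k : 'I_r, reshape_index lambda (p k) == reshape_index lambda k]].
Definition col_place_perms : {set 'S_r} :=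
  [set p : 'S_r | [forall k : 'I_r, reshape_offset lambda (p k) == reshape_offset lambda k]].

Lemma row_place_group_set : group_set row_place_perms.
Proof.
apply/group_setP; split=> [|p q].
  by rewrite inE; apply/forallP=> k; rewrite perm1.
rewrite !inE => /forallP rp /forallP rq; apply/forallP=> k.
by rewrite permM (eqP (rq _)) rp.
Qed.
Canonical row_place_group := Group row_place_group_set.

(* The tableaux row equivalent to t are the p * t with p in row_place_perms.  *)
Definition tabloid_of (t : 'S_r) : {set 'S_r} := (row_place_perms :* t)%g.

Definition tabloid := {C : {set 'S_r} | C \in [set tabloid_of t | t : 'S_r]}.

Definition tabloid_mx (g : 'S_r) : 'M[rat]_#|{: tabloid}| :=
  fin_mx (fun C D : tabloid => ((val C :* g)%g == val D)%:R).

Lemma tabloid_mx_repr : mx_repr [set: 'S_r] tabloid_mx.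
Proof.
split=> [|g h _ _].
  by apply: fin_mx1 => C D; rewrite rcoset1 val_eqE.
apply: fin_mxM => C D; have Cg : (val C :* g)%g \in [set tabloid_of t | t : 'S_r].
  case/imsetP: (valP C) => t _ ->; rewrite /tabloid_of -rcosetM.
  by apply/imsetP; exists (t * g)%g.
rewrite (bigD1 (Sub (val C :* g)%g Cg)) //= eqxx mul1r big1 ?addr0 ?rcosetM //.
move=> E; rewrite -val_eqE /= eq_sym => /negPf ->; exact: mul0r.
Qed.

Definition tabloid_repr : mx_representation rat [set: 'S_r] #|{: tabloid}| :=
  MxRepresentation tabloid_mx_repr.

(* The column stabiliser of t is { t^-1 * p * t | p in col_place_perms }, so  *)
(* e_t is the sum of sgn(p) {p * t} over these p.                             *)
Definition polytabloid (t : 'S_r) : 'rV[rat]_#|{: tabloid}| :=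
  \row_j \sum_(p in col_place_perms)
    (-1) ^+ odd_perm p * (tabloid_of (p * t)%g == val (enum_val j))%:R.

Definition specht_mx : 'M[rat]_#|{: tabloid}| :=
  (\sum_(t : 'S_r) <<polytabloid t>>)%MS.

Lemma polytabloidM t g : polytabloid t *m tabloid_repr g = polytabloid (t * g)%g.
Proof.
apply/rowP=> j; rewrite !mxE.
under eq_bigr do rewrite !mxE mulr_suml.
rewrite exchange_big /=; apply: eq_bigr => p _.
have pt : tabloid_of (p * t)%g \in [set tabloid_of t | t : 'S_r] by apply/imsetP; exists (p * t)%g.
rewrite (bigD1 (enum_rank (Sub (tabloid_of (p * t)%g) pt : tabloid))) //= enum_rankK /=.
rewrite eqxx mulr1 big1 ?addr0 => [|k].
  by rewrite /tabloid_of !rcosetM.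
rewrite -(inj_eq enum_val_inj) enum_rankK -val_eqE /= eq_sym => /negPf ->.
by rewrite mulr0 mul0r.
Qed.

Lemma specht_mxmodule : mxmodule tabloid_repr specht_mx.
Proof.
apply/mxmoduleP=> g _; rewrite sumsmxMr; apply/sumsmx_subP=> t _.
rewrite (eqmxMr _ (genmxE _)) polytabloidM.
by rewrite (sumsmx_sup (t * g)%g) // genmxE.
Qed.

Definition specht : mx_representation rat [set: 'S_r] (\rank specht_mx) :=
  submod_repr specht_mxmodule.

End Specht.

Section TableauFamilies.

(* A tableau is the sequence of its rows.  zip truncates the upper of two     *)
(* consecutive rows to the length of the lower one.                           *)
Definition conj_semistandard (mu : seq nat) (T : seq (seq nat)) : bool :=
  [&& shape T == mu,
      all (all (ltn 0)) T,
      all (sorted ltn) T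
    & sorted (fun row1 row2 => all (fun p => p.1 <= p.2)%N (zip row1 row2)) T].

Definition is_family_tuple (mu kappa : seq nat)
    (Ts : seq {fset seq (seq nat)}) : bool :=
  ([seq #|` Tfam|%fset | Tfam : {fset seq (seq nat)} <- Ts] == kappa)
  && all (fun Tfam : {fset seq (seq nat)} => all (conj_semistandard mu) Tfam) Ts.

Definition tuple_entries (Ts : seq {fset seq (seq nat)}) : seq nat :=
  flatten (flatten (flatten [seq enum_fset Tfam | Tfam <- Ts])).

Definition tuple_weight (Ts : seq {fset seq (seq nat)}) : seq nat :=
  let w := tuple_entries Ts in
  mkseq (fun j => count_mem j.+1 w) (\max_(x <- w) x).

Definition has_type (lambda : seq nat) (Ts : seq {fset seq (seq nat)}) : bool :=
  let gamma := tuple_weight Ts in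
  is_partition (sumn gamma) gamma && (conj_part gamma == lambda).

(* This set is finite, since the type determines the weight; fset_set of an   *)
(* infinite set would be empty.                                               *)
Definition family_tuple_count (mu kappa lambda : seq nat) : nat :=
  #|` fset_set [set` [pred Ts | is_family_tuple mu kappa Ts & has_type lambda Ts]] |%fset.

End TableauFamilies.

(* Main.v *)
From HB Require Import structures.
Require Import Defs.
From mathcomp Require Import classical_sets cardinality.
From mathcomp Require Import finmap.
From mathcomp Require Import all_boot all_order all_algebra all_fingroup.
From mathcomp Require Import mxrepresentation.
From mathcomp Require Import zify.

(* The Specht module of lambda is generated by a polytabloid on which the     *)
(* column stabiliser acts by signs, so the Hom space embeds into the vectors  *)
(* of the induced module that are antisymmetric under the Young subgroup of   *)
(* lambda'.  The induced module is generated by the vector E built from the   *)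
(* generating polytabloids of S^mu and S^nu, so these antisymmetric vectors   *)
(* are spanned by the sums of sgn(g) E g over the g that label the cells of n *)
(* mu-tableaux by a given filling of content lambda'.  As functions of the    *)
(* filling, these sums inherit every linear relation between polytabloids of  *)
(* shape mu with its sign removed; the Garnir relations then have positive    *)
(* coefficients and straighten each mu-tableau to a conjugate-semistandard    *)
(* one.  Exchanging two mu-tableaux is a product of m transpositions, so the  *)
(* relations between polytabloids of shape nu survive with signs if m is even *)
(* and without signs if m is odd.  In the first case the tableaux along each  *)
(* column of nu must be distinct and their order only matters up to sign; in  *)
(* the second case a further straightening, over an alphabet of tableaux,     *)
(* makes the rows of nu strictly increasing.                                  *)

Set Implicit Arguments.
Unset Strict Implicit.
Unset Printing Implicit Defensive.

(** The proof rests on a duality between vectors and fillings. Let [E] generate the induced module.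
    A homomorphism out of the Specht module is determined by a vector in the span of the signed sums
    of translates of [E], one for each filling of the [n] blocks ([dim_hom_specht]). A linear
    relation between translates [E s] becomes a relation between signed sums at the fillings
    composed with [s], each coefficient being multiplied by the sign of [s] ([signed_sum_relation]).

    For permutations inside a block this turns column antisymmetry into column symmetry and a Garnir
    relation into a sum with all coefficients one. Then an extremal argument ([straightening])
    reduces every filling to conjugate-semistandard ones. For permutations [h] of the blocks the
    twist is the sign of [h] to the power [m] ([odd_top_elt]). If [m] is odd the situation is the
    same and [straightening] applies again, with [mu]-tableaux as letters on the diagram of [nu]. If
    [m] is even the sums stay antisymmetric along columns of [nu], so a repeated tableau in a column
    gives zero.

    In both cases a surviving sum depends, up to a scalar, only on the sets of tableaux in the rows
    (odd [m]) or columns (even [m]) of [nu] ([straight_families]). These sets form a family tuple of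
    the required shape and type ([family_tuple_counted]), so the span has dimension at most the
    number of such tuples. *)

(** * Conjugate partitions *)

Lemma nth_sorted_geq (s : seq nat) i j :
  sorted geq s -> i <= j -> nth 0 s j <= nth 0 s i.
Proof.
move=> ss lij; case: (ltnP j (size s)) => [js|sj]; last by rewrite (nth_default _ sj).
have := sorted_leq_nth (rev_trans leq_trans) leqnn 0 ss.
by apply=> //; rewrite inE (leq_ltn_trans lij).
Qed.

(** Both sides say that the diagram of [s] has a cell in row [i] and column [j]: as the rows shrink,
    those reaching column [j] come first. This symmetry makes conjugation an involution. *)
Lemma ltn_count_nth (s : seq nat) i j :
  sorted geq s -> (i < count (ltn j) s) = (j < nth 0 s i).
Proof.
elim: s i => [|x s IHs] i ss /=; first by rewrite nth_nil.
have tl : sorted geq s := path_sorted ss.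
case: (ltnP j x) => jx; case: i => [|i] //=; first by rewrite add1n ltnS IHs.
  have h := @nth_sorted_geq (x :: s) 0 1 ss isT.
  by rewrite add0n IHs // !ltnNge jx (leq_trans h jx).
have h := @nth_sorted_geq (x :: s) 0 i.+1 ss isT.
have h1 := @nth_sorted_geq (x :: s) 0 i.+2 ss isT.
by rewrite add0n IHs // !ltnNge (leq_trans h jx) (leq_trans h1 jx).
Qed.

Lemma nth_conj_part s j : sorted geq s -> nth 0 (conj_part s) j = count (ltn j) s.
Proof.
move=> ss; rewrite /conj_part; case: (ltnP j (head 0 s)) => hj.
  by rewrite nth_mkseq.
rewrite nth_default ?size_mkseq //; apply/esym/eqP; rewrite -leqn0 leqNgt.
by rewrite ltn_count_nth // nth0 -leqNgt.
Qed.

Lemma sorted_conj_part s : sorted geq (conj_part s).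
Proof.
apply/(sortedP 0) => i; rewrite size_mkseq => hi.
rewrite !nth_mkseq //; last exact: ltnW.
by apply: sub_count => x /=; apply: ltnW.
Qed.

Lemma conj_part_gt0 s : all (ltn 0) (conj_part s).
Proof.
apply/allP=> x /mapP[j]; rewrite mem_iota /= add0n => hj ->.
by case: s hj => //= y s ->.
Qed.

Lemma head_conj_part s : all (ltn 0) s -> head 0 (conj_part s) = size s.
Proof.
move=> ps; transitivity (count (ltn 0) s); last by apply/eqP; rewrite -all_count.
by case: s ps => //= x s /andP[x0 _]; rewrite /conj_part /= -(prednK x0).
Qed.

Lemma conj_partK s : sorted geq s -> all (ltn 0) s -> conj_part (conj_part s) = s.
Proof.
move=> ss ps; have sc := sorted_conj_part s.
apply: (@eq_from_nth _ 0) => [|i _]; first by rewrite size_mkseq head_conj_part.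
have E j : (j < nth 0 (conj_part (conj_part s)) i) = (j < nth 0 s i).
  by rewrite nth_conj_part // ltn_count_nth // nth_conj_part // ltn_count_nth.
apply/eqP; rewrite eqn_leq; have := E (nth 0 s i).
have := E (nth 0 (conj_part (conj_part s)) i); rewrite !ltnn => /esym/negbT + /negbT.
by rewrite -!leqNgt => -> ->.
Qed.

(** * Rows and columns of the cells of a Young diagram *)

Section Cells.

Variables (r : nat) (mu : seq nat).
Hypothesis mu_part : is_partition r mu.

Definition cell_row (k : 'I_r) := reshape_index mu k.
Definition cell_col (k : 'I_r) := reshape_offset mu k.

Lemma partition_sorted : sorted geq mu. Proof. by case/and3P: mu_part. Qed.
Lemma partition_gt0 : all (ltn 0) mu. Proof. by case/and3P: mu_part. Qed.
Lemma partition_sumn : sumn mu = r. Proof. by case/and3P: mu_part => _ _ /eqP. Qed.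

Lemma cell_row_lt k : cell_row k < size mu.
Proof. by apply: reshape_indexP; rewrite partition_sumn. Qed.

Lemma cell_col_lt k : cell_col k < nth 0 mu (cell_row k).
Proof. by apply: reshape_offsetP; rewrite partition_sumn. Qed.

Lemma cell_flatten (k : 'I_r) : flatten_index mu (cell_row k) (cell_col k) = k.
Proof. exact: reshape_indexK. Qed.

Lemma cell_inj k l : cell_row k = cell_row l -> cell_col k = cell_col l -> k = l.
Proof. by move=> er ec; apply: val_inj; rewrite /= -(cell_flatten k) -(cell_flatten l) er ec. Qed.

Lemma cell_exists i j : j < nth 0 mu i -> exists k, cell_row k = i /\ cell_col k = j.
Proof.
move=> ij; have := flatten_indexP ij; rewrite partition_sumn => kr.
by exists (Ordinal kr); rewrite /cell_row /cell_col flatten_indexKl ?flatten_indexKr.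
Qed.

Lemma card_row j : #|[pred k | cell_row k == j]| = nth 0 mu j.
Proof.
apply/eqP; rewrite eqn_leq; apply/andP; split.
  case E: (nth 0 mu j) => [|q].
    rewrite leqn0; apply/eqP/eq_card0 => k; rewrite !inE; apply/negP=> /eqP kj.
    by have := cell_col_lt k; rewrite kj E.
  have hf : {in [pred k | cell_row k == j] &, injective (fun k => inord (cell_col k) : 'I_q.+1)}.
    move=> k l; rewrite !inE => /eqP kj /eqP lj /(congr1 val).
    rewrite /= !inordK; last 2 first.
    - by rewrite -E -lj cell_col_lt.
    - by rewrite -E -kj cell_col_lt.
    by apply: cell_inj; rewrite kj.
  by rewrite -(card_in_imset hf) (leq_trans (max_card _)) ?card_ord.
have ex (c : 'I_(nth 0 mu j)) : exists k, (cell_row k == j) && (cell_col k == c).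
  by have [k [kj kc]] := cell_exists (ltn_ord c); exists k; rewrite kj kc !eqxx.
pose f c := xchoose (ex c).
have fP c : cell_row (f c) = j /\ cell_col (f c) = c.
  by have /andP[/eqP ? /eqP ?] := xchooseP (ex c).
have fi : injective f.
  by move=> c d e; apply: val_inj; rewrite /= -(fP c).2 -(fP d).2 e.
rewrite -[X in X <= _]card_ord -(card_imset _ fi).
apply/subset_leq_card/subsetP => k /imsetP[c _ ->].
by rewrite inE (fP c).1.
Qed.

Lemma card_col j : #|[pred k | cell_col k == j]| = count (ltn j) mu.
Proof.
have -> : count (ltn j) mu = #|[pred i : 'I_(size mu) | j < nth 0 mu i]|.
  by rewrite -sum1_count (big_nth 0) big_mkord sum1_card.
pose f k := Ordinal (cell_row_lt k).
have fi : {in [pred k | cell_col k == j] &, injective f}.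
  move=> k l; rewrite !inE => /eqP kj /eqP lj /(congr1 val) /= e.
  by apply: cell_inj; rewrite ?kj.
rewrite -(card_in_imset fi); apply: eq_card => i; rewrite inE.
apply/imsetP/idP => [[k] | ij].
  by rewrite inE => /eqP <- ->; apply: cell_col_lt.
have [k [ki kj]] := cell_exists ij.
by exists k; [rewrite inE kj | apply: val_inj].
Qed.

End Cells.

(** The two lists of values agree as multisets. This later turns equality of contents into a
    permutation of cells or of tableaux. *)
Lemma perm_of_card_fibers (r : nat) (T : eqType) (f g : 'I_r -> T) :
  (forall y, #|[pred x | f x == y]| = #|[pred x | g x == y]|) ->
  exists p : 'S_r, forall x, g x = f (p x).
Proof.
move=> fg; have cnt (h : 'I_r -> T) y : count_mem y [tuple h i | i < r] = #|[pred x | h x == y]|.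
  by rewrite /= count_map -size_filter cardE; congr size; rewrite [RHS]/enum_mem enumT.
have /tuple_permP[p fgp] : perm_eq [tuple g i | i < r] [tuple f i | i < r].
  by apply/allP => y _; apply/eqP; rewrite !cnt fg.
exists p => x; have := congr1 (fun s => nth (g x) s x) fgp.
by rewrite -!tnth_nth !tnth_mktuple.
Qed.

(** * Column and Garnir relations between polytabloids *)

Section SpechtRelations.

Import GroupScope GRing.Theory Num.Theory.
Local Open Scope ring_scope.

Variables (r : nat) (mu : seq nat).

Notation row k := (cell_row mu k).
Notation col k := (cell_col mu k).

Lemma col_place_group_set : group_set (col_place_perms r mu).
Proof.
apply/group_setP; split=> [|p q].
  by rewrite inE; apply/forallP=> k; rewrite perm1.
rewrite !inE => /forallP rp /forallP rq; apply/forallP=> k.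
by rewrite permM (eqP (rq _)) rp.
Qed.
Canonical col_place_group := Group col_place_group_set.

Lemma col_place_permsP (p : 'S_r) :
  reflect (forall k, col (p k) = col k) (p \in col_place_perms r mu).
Proof. by rewrite inE; apply: (iffP forallP) => h k; apply/eqP; exact: h. Qed.

Lemma polytabloid_col (p : 'S_r) : p \in col_place_perms r mu ->
  polytabloid mu p = (-1) ^+ odd_perm p *: polytabloid mu 1%g.
Proof.
move=> colp; apply/rowP=> j; rewrite !mxE mulr_sumr.
rewrite (reindex_inj (mulIg p^-1)%g) /=.
under eq_bigl => q do rewrite (@groupMr _ col_place_group) ?groupV //.
apply: eq_bigr => q _; rewrite mulgKV mulg1 mulrA; congr (_ * _).
by rewrite odd_permM odd_permV signr_addb mulrC.
Qed.

(** For a fixed column permutation [p], let [t] swap two cells of [X] that the inverse of [p] puts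
    into one row. The terms of [s] and [t * s] have opposite signs and equal tabloids, so the
    contribution of [p] is its own negative. *)
Lemma garnir_relation (X : {set 'I_r}) :
    (forall p : 'S_r, p \in col_place_perms r mu ->
      exists x y, [/\ x \in X, y \in X, x != y & row (p x) = row (p y)]) ->
  \sum_(s : 'S_r | perm_on X s) (-1) ^+ odd_perm s *: polytabloid mu s = 0.
Proof.
move=> rowX; apply/rowP=> j; rewrite summxE mxE.
under eq_bigr do rewrite !mxE mulr_sumr.
rewrite exchange_big /= big1 // => p colp.
have [x [y [xX yX neq_xy rowxy]]] := rowX _ (groupVr colp).
set S := \sum_(_ | _) _; suff : S = - S by move/eqP; rewrite -addr_eq0 -mulr2n mulrn_eq0 => /eqP.
pose t := tperm x y.
have tX : perm_on X t.
  by apply/subsetP=> z; rewrite inE /t; case: tpermP => [-> | -> |]; rewrite ?eqxx.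
have ontX s : perm_on X (t * s)%g = perm_on X s.
  apply/idP/idP => [h|]; last exact: perm_onM.
  by rewrite -[s](mulKg t) tpermV perm_onM.
rewrite {1}/S (reindex_inj (mulgI t)) /= -sumrN.
apply: eq_big => // s _; rewrite odd_permM /t odd_tperm neq_xy /= signrN mulNr.
congr (- (_ * (_ * (_ == _)%:R))).
(* Moving [t] to the left of [p] conjugates it into a transposition within one row, which the coset
   of row permutations absorbs. *)
rewrite /tabloid_of mulgA (_ : p * t = tperm (p^-1 x) (p^-1 y) * p)%g.
  rewrite -mulgA rcosetM rcoset_id // inE; apply/forallP=> k.
  by case: tpermP => [->|->|] //; rewrite -[reshape_index _ _]/(row _) -?rowxy // rowxy.
by rewrite -tpermJ conjgE invgK mulgA mulgKV.
Qed.

End SpechtRelations.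

(** * Fillings, Garnir sets and the effect of a Garnir exchange *)

Definition fperm (r : nat) (T : Type) (a : {ffun 'I_r -> T}) (s : 'S_r) : {ffun 'I_r -> T} :=
  [ffun k => a (s k)].

Definition conj_ss_filling (r B : nat) (mu : seq nat) (b : {ffun 'I_r -> 'I_B}) : bool :=
  [forall k, forall l,
     ((cell_col mu k == cell_col mu l) && (cell_row mu l == (cell_row mu k).+1) ==> (b k <= b l))
  && ((cell_row mu k == cell_row mu l) && (cell_col mu l == (cell_col mu k).+1) ==> (b k < b l))].

Section Garnir.

Import GroupScope GRing.Theory Num.Theory.

Variables (r : nat) (mu : seq nat).
Hypothesis mu_part : is_partition r mu.

Notation row k := (cell_row mu k).
Notation col k := (cell_col mu k).

Definition garnir_left (k : 'I_r) := [set x : 'I_r | (col x == col k) && (row k <= row x)].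
Definition garnir_right (k : 'I_r) := [set x : 'I_r | (col x == (col k).+1) && (row x <= row k)].

(** A column permutation keeps the Garnir set within the rows that reach the column of [k]. The two
    halves of the set together occupy all these rows and both occupy the row of [k], so there are
    more cells than rows. *)
Lemma garnir_pigeonhole (k l : 'I_r) (p : 'S_r) :
    row l = row k -> col l = (col k).+1 -> p \in col_place_perms r mu ->
  exists x y, [/\ x \in garnir_left k :|: garnir_right k,
                  y \in garnir_left k :|: garnir_right k,
                  x != y & row (p x) = row (p y)].
Proof.
set A := garnir_left k; set C := garnir_right k; set X := A :|: C => lk_row lk_col.
move=> /col_place_permsP colp.
have rowlt x : row x < size mu := cell_row_lt mu_part x.
pose rw x := Ordinal (rowlt x).
case: (pickP [pred z : 'I_r * 'I_r | [&& z.1 \in X, z.2 \in X, z.1 != z.2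
                                       & row (p z.1) == row (p z.2)]]) => [[x y] | inj].
  by case/and4P=> /= ? ? ? /eqP; exists x, y.
have injX : {in X &, injective (fun x => rw (p x))}.
  move=> x y xX yX /(congr1 val) /= e; apply/eqP/negPn/negP => neq.
  by have := inj (x, y); rewrite /= xX yX neq e eqxx.
pose R := [set i : 'I_(size mu) | col k < nth 0 mu i].
have XR : (fun x => rw (p x)) @: X \subset R.
  apply/subsetP=> _ /imsetP[x xX ->]; rewrite inE /=.
  apply: leq_ltn_trans (cell_col_lt mu_part (p x)); rewrite colp.
  by move: xX; rewrite !inE => /orP[] /andP[/eqP-> _].
have := subset_leq_card XR; rewrite card_in_imset // => leXR.
have disj : A :&: C = set0.
  apply/setP=> x; rewrite !inE; apply/negP => /andP[/andP[/eqP-> _] /andP[/eqP e _]].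
  exact: (n_Sn _ e).
have colinj (c : nat) : {in [pred x | col x == c] &, injective rw}.
  move=> x y; rewrite !inE => /eqP cx /eqP cy /(congr1 val) /= e.
  by apply: (cell_inj e); rewrite cx.
have cA : #|rw @: A| = #|A|.
  by apply: card_in_imset => x y; rewrite !inE => /andP[cx _] /andP[cy _]; apply: (colinj (col k)).
have cC : #|rw @: C| = #|C|.
  apply: card_in_imset => x y; rewrite !inE => /andP[cx _] /andP[cy _].
  exact: (colinj (col k).+1).
have cover : R \subset rw @: A :|: rw @: C.
  apply/subsetP=> i; rewrite !inE => ki; case: (leqP (row k) i) => ri.
    have [x [xr xc]] := cell_exists mu_part ki; apply/orP; left; apply/imsetP; exists x.
      by rewrite inE xc eqxx xr.
    exact: val_inj.
  have li : (col k).+1 < nth 0 mu i.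
    rewrite -lk_col; apply: leq_trans (cell_col_lt mu_part l) _.
    by rewrite lk_row; apply: nth_sorted_geq (partition_sorted mu_part) (ltnW ri).
  have [x [xr xc]] := cell_exists mu_part li; apply/orP; right; apply/imsetP; exists x.
    by rewrite inE xc eqxx xr ltnW.
  exact: val_inj.
have meet : 0 < #|rw @: A :&: rw @: C|.
  apply/card_gt0P; exists (rw k); rewrite inE; apply/andP; split; apply/imsetP.
    by exists k; rewrite ?inE ?eqxx /=.
  exists l; first by rewrite inE lk_col lk_row eqxx /=.
  exact: val_inj.
have := cardsUI (rw @: A) (rw @: C); have := subset_leq_card cover.
have := cardsUI A C; rewrite disj cards0 cA cC -/X addn0 => e1 le1 e2.
by have := leq_ltn_trans le1 (leq_trans _ leXR); rewrite e1 -e2 -addn1 leq_add2l ltnn => /(_ meet).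
Qed.

End Garnir.

Section Potential.

Variables (r : nat) (w : 'I_r -> nat).

Definition potential B (b : {ffun 'I_r -> 'I_B}) : nat := \sum_x w x * b x.

Lemma potential_tperm B (b : {ffun 'I_r -> 'I_B}) k l : k != l ->
  potential (fperm b (tperm k l)) + w k * b k + w l * b l =
  potential b + w k * b l + w l * b k.
Proof.
move=> neq; rewrite /potential (bigD1 k) //= (bigD1 l) 1?eq_sym //=.
rewrite [in RHS](bigD1 k) //= [in RHS](bigD1 l) 1?eq_sym //= !ffunE tpermL tpermR.
rewrite (eq_bigr (fun x => w x * b x)); first lia.
by move=> x /andP[xk xl]; rewrite !ffunE tpermD // eq_sym.
Qed.

End Potential.

(** Passing from [C] to [D] trades values at most [v] for equally many values at least [v]. If the
    sums agree, all traded values equal [v]; since [h] is arbitrary, the conclusion then says that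
    [f] has the same multiset of values on [C] and on [D]. *)
Lemma sum_exchange (T : finType) (D C : {set T}) (f : T -> nat) v :
    #|D| = #|C| -> (forall y, y \in D :\: C -> v <= f y) ->
    (forall y, y \in C :\: D -> f y <= v) ->
  \sum_(y in C) f y <= \sum_(y in D) f y
  /\ (\sum_(y in C) f y = \sum_(y in D) f y ->
      forall h : nat -> nat, \sum_(y in D) h (f y) = \sum_(y in C) h (f y)).
Proof.
move=> cDC vD vC.
have q : #|D :\: C| = #|C :\: D|.
  by have := cardsID C D; have := cardsID D C; rewrite setIC; lia.
have spl (g : T -> nat) (X Y : {set T}) :
    \sum_(y in X) g y = \sum_(y in X :&: Y) g y + \sum_(y in X :\: Y) g y.
  by rewrite (big_setID Y).
have leD : #|D :\: C| * v <= \sum_(y in D :\: C) f y ?= iff [forall (y | y \in D :\: C), v == f y].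
  by rewrite -sum_nat_const; apply: leqif_sum => y yD; apply/leqif_eq/vD.
have leC : \sum_(y in C :\: D) f y <= #|C :\: D| * v ?= iff [forall (y | y \in C :\: D), f y == v].
  by rewrite -sum_nat_const; apply: leqif_sum => y yD; apply/leqif_eq/vC.
have := spl f C D; have := spl f D C; rewrite [D :&: C]setIC => e1 e2.
split; first by case: leD leC => [h1 _] [h2 _]; rewrite q in h1; lia.
move=> e h; rewrite (spl _ C D) (spl _ D C) [D :&: C]setIC; congr addn.
case: leD leC => [h1 i1] [h2 i2]; rewrite q in h1 i1.
have /eqP f1 : #|C :\: D| * v == \sum_(y in D :\: C) f y by apply/eqP; lia.
have /eqP f2 : \sum_(y in C :\: D) f y == #|C :\: D| * v by apply/eqP; lia.
move: i1 i2; rewrite -f1 f2 !eqxx => /esym/forallP i1 /esym/forallP i2.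
transitivity (#|C :\: D| * h v).
  rewrite -q -sum_nat_const; apply: eq_bigr => y yD.
  by have := i1 y; rewrite yD => /eqP <-.
rewrite -sum_nat_const; apply: eq_bigr => y yD.
by have := i2 y; rewrite yD => /eqP <-.
Qed.

Section GarnirExchange.

Variables (r B : nat) (mu : seq nat).

Notation row k := (cell_row mu k).
Notation col k := (cell_col mu k).

(* Entries of the left part dominate those of the right part, so permuting *)
(* the cells of the Garnir set can only move large entries to the right.   *)
Lemma garnir_exchange (b : {ffun 'I_r -> 'I_B}) (k l : 'I_r) (s : 'S_r) :
    (forall x y, col x = col y -> row x <= row y -> b x <= b y) ->
    row l = row k -> col l = (col k).+1 -> b l <= b k ->
    perm_on (garnir_left mu k :|: garnir_right mu k) s ->
  potential (cell_col mu) b <= potential (cell_col mu) (fperm b s)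
  /\ (potential (cell_col mu) b = potential (cell_col mu) (fperm b s) ->
      exists2 p : 'S_r, p \in col_place_perms r mu & fperm b s = fperm b p).
Proof.
set A := garnir_left mu k; set C := garnir_right mu k => bcol lk_row lk_col blk son.
have disj : [disjoint A & C].
  rewrite -setI_eq0; apply/eqP/setP=> x; rewrite !inE.
  by apply/negP => /andP[/andP[/eqP-> _] /andP[/eqP e _]]; apply: (n_Sn _ e).
have sX x : (s x \in A :|: C) = (x \in A :|: C) := perm_closed x son.
(* [D] consists of the cells whose entries [s] brings into [C]. *)
pose D := s @: C.
have bA x : x \in A -> b k <= b x.
  by rewrite inE => /andP[/eqP cx rx]; apply: bcol.
have bC x : x \in C -> b x <= b k.
  rewrite inE => /andP[/eqP cx rx]; apply: leq_trans blk; apply: bcol; first by rewrite cx.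
  by rewrite lk_row.
have DA y : y \in D :\: C -> y \in A.
  case/setDP => /imsetP[x xC ->] nsC.
  by have := sX x; rewrite [x \in _]inE xC orbT inE (negPf nsC) orbF.
have cDC : #|D| = #|C| by rewrite card_imset //; apply: perm_inj.
have CC y : y \in C :\: D -> b y <= b k by case/setDP => yC _; apply: bC.
have [le1 eq1] := sum_exchange cDC (fun y yD => bA y (DA y yD)) CC.
have sumD (h : 'I_B -> nat) : \sum_(y in D) h (b y) = \sum_(x in C) h (b (s x)).
  by rewrite big_imset //; apply: in2W; apply: perm_inj.
have sumX (h : 'I_B -> nat) : \sum_(x in A :|: C) h (b (s x)) = \sum_(x in A :|: C) h (b x).
  by rewrite [RHS](reindex_inj (@perm_inj _ s)); apply: eq_bigl => x; rewrite sX.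
have sumU (g : 'I_r -> nat) :
    \sum_(x in A :|: C) g x = \sum_(x in A) g x + \sum_(x in C) g x.
  by rewrite -bigU //=; apply: eq_bigl => x; rewrite !inE.
have split_sum (h : nat -> 'I_B -> nat) (f : 'I_r -> 'I_B) :
    \sum_x h (col x) (f x) = \sum_(x in A) h (col k) (f x) + \sum_(x in C) h (col k).+1 (f x)
      + \sum_(x | x \notin A :|: C) h (col x) (f x).
  rewrite (bigID (mem (A :|: C))) /= sumU; congr (_ + _ + _).
    by apply: eq_bigr => x; rewrite inE => /andP[/eqP-> _].
  by apply: eq_bigr => x; rewrite inE => /andP[/eqP-> _].
have out (h : nat -> 'I_B -> nat) :
    \sum_(x | x \notin A :|: C) h (col x) (b (s x)) = \sum_(x | x \notin A :|: C) h (col x) (b x).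
  by apply: eq_bigr => x xX; rewrite (out_perm son).
(* The two halves lie in adjacent columns, so the column potential changes exactly by the change of
   the entry sum over [C]. *)
have potE : potential (cell_col mu) (fperm b s) + \sum_(y in C) b y
    = potential (cell_col mu) b + \sum_(y in D) b y.
  rewrite /potential; under eq_bigr do rewrite ffunE.
  rewrite (split_sum (fun c x => c * x) (fun x => b (s x))).
  rewrite (split_sum (fun c x => c * x) (fun x => b x)) (out (fun c x => c * x)).
  have := sumX (fun x => x); rewrite !sumU (sumD (fun x => x)) -!big_distrr /=; nia.
split=> [|potEq].
  by rewrite -(leq_add2r (\sum_(y in C) b y)) potE leq_add2l.
have sumCD : \sum_(y in C) b y = \sum_(y in D) b y.
  by apply: (@addnI (potential (cell_col mu) b)); rewrite -potE -potEq.
have eq2 h : \sum_(y in C) h (b (s y)) = \sum_(y in C) h (b y).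
  rewrite -sumD.
  (* [sum_exchange] takes test functions on numbers; [h] is extended past the alphabet by its value
     at the letter zero. *)
  have B_gt0 : 0 < B := leq_ltn_trans (leq0n _) (ltn_ord (b k)).
  have := eq1 sumCD (fun v => h (insubd (Ordinal B_gt0) v)).
  by under eq_bigr do rewrite valKd; under [in X in _ = X -> _]eq_bigr do rewrite valKd.
(* Each column contains each letter equally often before and after, so a permutation within columns
   links the two fillings. *)
have [p pP] : exists p : 'S_r, forall x, (col x, b (s x)) = (col (p x), b (p x)).
  apply: (@perm_of_card_fibers _ _ (fun x => (col x, b x))) => -[c v].
  pose h d (x : 'I_B) : nat := (d == c) && (x == v).
  have cnt (f : 'I_r -> 'I_B) : #|[pred x | (col x, f x) == (c, v)]| = \sum_x h (col x) (f x).
    rewrite -sum1_card big_mkcond; apply: eq_bigr => x _.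
    by rewrite inE xpair_eqE /h; case: (_ && _).
  rewrite !cnt !split_sum out eq2; congr (_ + _ + _).
  by have := sumX (h (col k)); rewrite !sumU eq2; lia.
exists p; first by apply/col_place_permsP => x; case: (pP x).
by apply/ffunP=> x; rewrite !ffunE; case: (pP x).
Qed.

End GarnirExchange.

(** * Straightening under sign-twisted Specht relations *)

Section ColumnRelation.

Import GroupScope GRing.Theory Num.Theory.
Local Open Scope ring_scope.

(** This is [polytabloid_col] written as a relation supported on [p] and [1], so that [rel] applies.
    With [f] the sign it makes [g] invariant under column permutations; with [f] constant it makes
    [g] antisymmetric. *)
Lemma col_place_relation (r : nat) (mu : seq nat) (V : lmodType rat)
    (f : 'S_r -> rat) (g : 'S_r -> V) (p : 'S_r) :
    (forall c : 'S_r -> rat, \sum_s c s *: polytabloid mu s = 0 ->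
      \sum_s (c s * f s) *: g s = 0) ->
    p \in col_place_perms r mu ->
  f p *: g p = ((-1) ^+ odd_perm p * f 1%g) *: g 1%g.
Proof.
move=> rel colp.
have sumE (f' : 'S_r -> rat) (V' : lmodType rat) (g' : 'S_r -> V') :
    \sum_s (((s == p)%:R - (-1) ^+ odd_perm p * (s == 1%g)%:R) * f' s) *: g' s =
    f' p *: g' p - ((-1) ^+ odd_perm p * f' 1%g) *: g' 1%g.
  under eq_bigr do rewrite mulrBl scalerBl.
  rewrite sumrB; congr (_ - _).
    rewrite (bigD1 p) //= eqxx mul1r big1 ?addr0 // => s /negPf->.
    by rewrite mul0r scale0r.
  rewrite (bigD1 1%g) //= eqxx mulr1 big1 ?addr0 // => s /negPf->.
  by rewrite mulr0 mul0r scale0r.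
have rel0 : \sum_s ((s == p)%:R - (-1) ^+ odd_perm p * (s == 1%g)%:R) *: polytabloid mu s = 0.
  under eq_bigr do rewrite -[X in X *: _]mulr1.
  by rewrite (sumE (fun=> 1)) !mulr1 scale1r (polytabloid_col colp) subrr.
by have /= := rel _ rel0; rewrite sumE => /subr0_eq.
Qed.

End ColumnRelation.

Section Straightening.

Import GroupScope GRing.Theory Num.Theory.
Local Open Scope ring_scope.

Variables (r B N u : nat) (mu : seq nat).
Hypothesis mu_part : is_partition r mu.
Variables (F : {ffun 'I_r -> 'I_B} -> 'rV[rat]_N) (U : 'M[rat]_(u, N)).

Hypothesis F_relation : forall c : 'S_r -> rat,
  \sum_s c s *: polytabloid mu s = 0 ->
  forall a, \sum_s (c s * (-1) ^+ odd_perm s) *: F (fperm a s) = 0.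
Hypothesis F_conj_ss : forall b, conj_ss_filling mu b -> (F b <= U)%MS.

Notation row k := (cell_row mu k).
Notation col k := (cell_col mu k).

Lemma filling_col_perm a (p : 'S_r) : p \in col_place_perms r mu -> F (fperm a p) = F a.
Proof.
move=> colp.
have := col_place_relation (fun c rel => F_relation rel a) colp.
rewrite odd_perm1 mulr1 => /(congr1 (GRing.scale ((-1) ^+ odd_perm p))).
rewrite !scalerA -signr_addb addbb !scale1r => ->; congr F.
by apply/ffunP=> x; rewrite ffunE perm1.
Qed.

(* A bad filling maximising the entries first towards the right and then  *)
(* towards the bottom has weakly increasing columns, and every other term *)
(* of a Garnir relation at a row violation is good or equal to it.        *)
Lemma straightening a : (F a <= U)%MS.
Proof.
apply/negPn/negP => bad_a.
(* [K] exceeds every row potential, so [Phi] compares column potentials first and row potentials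
   second. *)
pose K := (\max_(b : {ffun 'I_r -> 'I_B}) potential (cell_row mu) b).+1%N.
have ltK (b : {ffun 'I_r -> 'I_B}) : (potential (cell_row mu) b < K)%N.
  by rewrite ltnS; apply: leq_bigmax.
pose Phi (b : {ffun 'I_r -> 'I_B}) := (potential (cell_col mu) b * K + potential (cell_row mu) b)%N.
case: (@arg_maxnP _ a (fun b => ~~ (F b <= U)%MS) Phi bad_a) => b bad_b max_b.
have goodP (b' : {ffun 'I_r -> 'I_B}) :
    (potential (cell_col mu) b < potential (cell_col mu) b')%N -> (F b' <= U)%MS.
  move=> lt_b; apply/negPn/negP => /max_b; rewrite /Phi.
  have := ltK b; have := ltK b'; nia.
(* Swapping a descent in a column preserves [F] and the column potential but raises the row
   potential, against maximality. *)
have step x y : col x = col y -> row y = (row x).+1 -> (b x <= b y)%N.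
  move=> cxy rxy; rewrite leqNgt; apply/negP => lt_yx.
  have neq : x != y by apply/eqP => e; move: rxy; rewrite e => /n_Sn.
  have colt : tperm x y \in col_place_perms r mu.
    by apply/col_place_permsP => z; case: tpermP => [->|->|].
  have := max_b (fperm b (tperm x y)); rewrite filling_col_perm // => /(_ bad_b).
  rewrite /Phi.
  have := potential_tperm (cell_row mu) b neq; have := potential_tperm (cell_col mu) b neq.
  rewrite rxy cxy => e1 e2.
  move: e1; rewrite addnAC => /addIn/addIn ->.
  move: e2 lt_yx; rewrite /= leq_add2l.
  by move: (potential _ _) (potential _ _) (row x) (b x : nat) (b y : nat); clear; nia.
have bcol x y : col x = col y -> (row x <= row y)%N -> (b x <= b y)%N.
  move=> cxy rxy; have [d e] : exists d, row y = (row x + d)%N.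
    by exists (row y - row x)%N; rewrite subnKC.
  elim: d y cxy rxy e => [|d IHd] y cxy rxy e.
    by rewrite (cell_inj (l := x) _ (esym cxy)) // e addn0.
  have [z [zr zc]] : exists z : 'I_r, row z = (row x + d)%N /\ col z = col x.
    apply: cell_exists => //; rewrite cxy; apply: leq_trans (cell_col_lt mu_part y) _.
    by apply: nth_sorted_geq (partition_sorted mu_part) _; rewrite e leq_add2l.
  apply: (@leq_trans (b z)); first by apply: IHd; rewrite // zr leq_addr.
  by apply: step; rewrite ?zc // zr e addnS.
apply/negP: bad_b; rewrite negbK.
have [/F_conj_ss //|] := boolP (conj_ss_filling mu b).
rewrite negb_forall => /existsP[k]; rewrite negb_forall => /existsP[l].
rewrite negb_and => /orP[]; rewrite negb_imply => /andP[/andP[/eqP e1 /eqP e2]].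
  by rewrite step.
rewrite -leqNgt => blk.
set X := garnir_left mu k :|: garnir_right mu k.
(* The sign in [F_relation] cancels the sign in the Garnir relation, so every coefficient is one. *)
have garnir : \sum_(s : 'S_r | perm_on X s) F (fperm b s) = 0.
  have rel := @garnir_relation r mu X (fun p colp => garnir_pigeonhole mu_part (esym e1) e2 colp).
  have := F_relation (c := fun s => if perm_on X s then (-1) ^+ odd_perm s else 0).
  move=> /(_ _ b) rel2; rewrite -[RHS]rel2.
    rewrite [LHS]big_mkcond; apply: eq_bigr => s _.
    by case: ifP; rewrite ?mul0r ?scale0r // -signr_addb addbb scale1r.
  rewrite -[RHS]rel [RHS]big_mkcond; apply: eq_bigr => s _.
  by case: ifP; rewrite ?scale0r.
(* Terms with unchanged column potential all equal [F b]; the others have a larger one and lie in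
   [U] by maximality. *)
pose E s := potential (cell_col mu) b == potential (cell_col mu) (fperm b s).
move: garnir; rewrite (bigID E) /=.
rewrite (eq_bigr (fun _ => F b)) => [|s /andP[son /eqP pot]]; last first.
  have [_ /(_ pot)[p colp ->]] := garnir_exchange bcol (esym e1) e2 blk son.
  exact: filling_col_perm.
rewrite sumr_const => /eqP.
rewrite addr_eq0 => /eqP sumE.
set q := #|_| in sumE.
(* The identity is among the terms equal to [F b], so their number can be divided out. *)
have q_neq0 : (q%:R : rat) != 0.
  rewrite pnatr_eq0 -lt0n; apply/card_gt0P; exists 1%g; rewrite unfold_in perm_on1 /E /=.
  by apply/eqP; congr potential; apply/ffunP=> x; rewrite ffunE perm1.
rewrite -[F b](scalerK q_neq0) scaler_nat sumE scalemx_sub // -sumrN summx_sub // => s.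
case/andP=> son neq; rewrite eqmx_opp; apply: goodP; rewrite ltn_neqAle neq /=.
by have [] := garnir_exchange bcol (esym e1) e2 blk son.
Qed.

End Straightening.

(** * Elements of the wreath product and their signs *)

Section WreathElements.

Import GroupScope.

Variables (m n : nat).

Lemma mxvec_index_inj (a b : 'I_m) (i j : 'I_n) :
  mxvec_index a i = mxvec_index b j -> a = b /\ i = j.
Proof. by move/(congr1 (@block_offset m n)); rewrite !block_offsetK => -[-> ->]. Qed.

Section Wr.

Variables (b : 'I_n -> 'S_m) (h : 'S_n).

Definition wreath_fun (x : 'I_(m * n)) := mxvec_index (b (block x) (offset x)) (h (block x)).

Lemma wreath_fun_inj : injective wreath_fun.
Proof.
move=> x y /mxvec_index_inj[eb /perm_inj eh]; move: eb; rewrite eh => /perm_inj eo.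
by rewrite -(mxvec_indexK x) -(mxvec_indexK y) eh eo.
Qed.

Definition wreath_elt : 'S_(m * n) := perm wreath_fun_inj.

Lemma wreath_eltE a i : wreath_elt (mxvec_index a i) = mxvec_index (b i a) (h i).
Proof. by rewrite permE /wreath_fun blockE offsetE. Qed.

Lemma wreath_elt_in : wreath_elt \in wreath_set m n.
Proof. by apply/wreathP=> x y; rewrite !permE /wreath_fun !blockE => ->. Qed.

Lemma top_wreath_elt (m_gt0 : 0 < m) : top_perm m_gt0 wreath_elt = h.
Proof.
apply/permP=> i; rewrite -{1}(blockE (Ordinal m_gt0) i) top_permE ?wreath_elt_in //.
by rewrite wreath_eltE blockE.
Qed.

Lemma base_wreath_elt i : base_perm wreath_elt i = b i.
Proof.
apply/permP=> a; have := base_permE (mxvec_index a i) wreath_elt_in.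
by rewrite wreath_eltE blockE !offsetE.
Qed.

End Wr.

Lemma odd_perm_hom k l (phi : 'S_k -> 'S_l) (e : bool) :
    phi 1 = 1 -> {morph phi : s t / s * t} ->
    (forall x y, x != y -> odd_perm (phi (tperm x y)) = e) ->
  forall s, odd_perm (phi s) = e && odd_perm s.
Proof.
move=> phi1 phiM phit s; have [ts -> ds] := prod_tpermP s.
elim: ts ds => [_|t ts IHts /= /andP[dt dts]].
  by rewrite big_nil phi1 !odd_perm1 andbF.
rewrite big_cons phiM !odd_permM IHts // phit // odd_tperm dt.
by case: (e); case: (odd_perm _).
Qed.

Definition base_elt (j : 'I_n) (s : 'S_m) : 'S_(m * n) :=
  wreath_elt (fun i => if i == j then s else 1) 1.

Definition top_elt (h : 'S_n) : 'S_(m * n) := wreath_elt (fun=> 1) h.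

Lemma odd_base_elt j s : odd_perm (base_elt j s) = odd_perm s.
Proof.
apply: (@odd_perm_hom _ _ (base_elt j) true) => [|s1 s2|x y xy].
- apply/permP => z; case/mxvec_indexP: z => a i.
  by rewrite wreath_eltE !perm1; case: ifP; rewrite ?perm1.
- apply/permP => z; case/mxvec_indexP: z => a i.
  by rewrite permM !wreath_eltE !perm1; case: ifP; rewrite ?permM ?perm1.
rewrite (_ : base_elt _ _ = tperm (mxvec_index x j) (mxvec_index y j)).
  by rewrite odd_tperm; apply: contraNneq xy => /mxvec_index_inj[->].
apply/permP => z; case/mxvec_indexP: z => a i; rewrite wreath_eltE perm1.
case: eqP => [->|ij].
  case: tpermP => [->|->|ax ay]; rewrite ?tpermL ?tpermR // tpermD //.
    by apply/eqP => /mxvec_index_inj[/esym].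
  by apply/eqP => /mxvec_index_inj[/esym].
by rewrite perm1 tpermD //; apply/eqP => /mxvec_index_inj[_ /esym].
Qed.

(** A transposition of two blocks is a product of [m] disjoint transpositions, one for each offset.
    This is where the parity of [m] enters. *)
Lemma odd_top_elt h : odd_perm (top_elt h) = odd m && odd_perm h.
Proof.
apply: (@odd_perm_hom _ _ top_elt (odd m)) => [|h1 h2|i j ij].
- by apply/permP => z; case/mxvec_indexP: z => a i; rewrite wreath_eltE !perm1.
- by apply/permP => z; case/mxvec_indexP: z => a i; rewrite permM !wreath_eltE !perm1 permM.
pose ts := [seq (mxvec_index a i, mxvec_index a j) | a <- enum 'I_m].
have dts : all dpair ts.
  by apply/allP => _ /mapP[a _ ->]; apply: contraNneq ij => /= /mxvec_index_inj[_ ->].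
rewrite (_ : top_elt _ = \prod_(t <- ts) tperm t.1 t.2).
  by rewrite odd_perm_prod // size_map size_enum_ord.
apply/permP => z; case/mxvec_indexP: z => a k; rewrite wreath_eltE perm1 big_map.
(* The product is computed over any duplicate-free list of offsets so that induction applies. *)
suff E (s : seq 'I_m) : uniq s ->
    (\prod_(c <- s) tperm (mxvec_index c i) (mxvec_index c j)) (mxvec_index a k)
    = mxvec_index a (if a \in s then tperm i j k else k).
  by rewrite E ?enum_uniq // mem_enum.
elim: s k => [|c s IHs] k /=; first by rewrite big_nil perm1.
case/andP => cs us; rewrite big_cons permM inE; have [eac|ac] := eqVneq a c; first subst c.
  have -> : tperm (mxvec_index a i) (mxvec_index a j) (mxvec_index a k)
      = mxvec_index a (tperm i j k).
    case: (tpermP i j k) => [->|->|ki kj]; rewrite ?tpermL ?tpermR // tpermD //.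
      by apply/eqP => /mxvec_index_inj[_ /esym].
    by apply/eqP => /mxvec_index_inj[_ /esym].
  by rewrite IHs // (negPf cs).
rewrite tpermD ?IHs //; apply: contraNneq ac => /mxvec_index_inj[-> _] //.
Qed.

Definition assemble (T : Type) (t : {ffun 'I_n -> {ffun 'I_m -> T}}) : {ffun 'I_(m * n) -> T} :=
  [ffun x => t (block x) (offset x)].

Definition split_blocks (T : Type) (a : {ffun 'I_(m * n) -> T}) : {ffun 'I_n -> {ffun 'I_m -> T}} :=
  [ffun i => [ffun c => a (mxvec_index c i)]].

Lemma split_blocksK T : cancel (@split_blocks T) (@assemble T).
Proof. by move=> a; apply/ffunP=> x; rewrite !ffunE mxvec_indexK. Qed.

Lemma fperm_top_elt T (t : {ffun 'I_n -> {ffun 'I_m -> T}}) h :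
  fperm (assemble t) (top_elt h) = assemble (fperm t h).
Proof.
apply/ffunP=> x; case/mxvec_indexP: x => a i.
by rewrite !ffunE wreath_eltE !(blockE, offsetE) perm1.
Qed.

Definition set_block (T : Type) (t : {ffun 'I_n -> {ffun 'I_m -> T}}) j x :=
  [ffun i => if i == j then x else t i].

Lemma fperm_base_elt T (t : {ffun 'I_n -> {ffun 'I_m -> T}}) j x s :
  fperm (assemble (set_block t j x)) (base_elt j s) = assemble (set_block t j (fperm x s)).
Proof.
apply/ffunP=> z; case/mxvec_indexP: z => a i.
rewrite !ffunE wreath_eltE !(blockE, offsetE) perm1.
by case: eqP => // _; rewrite ?ffunE ?perm1.
Qed.

End WreathElements.

(** * Cyclic generators of Specht and induced modules *)

Section Generators.

Import GroupScope GRing.Theory Num.Theory.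
Local Open Scope ring_scope.

Lemma fin_mx_mul (F : fieldType) (I : finType) (E : I -> I -> F) (x : 'rV_#|I|) j :
  (x *m fin_mx E) 0 j = \sum_p x 0 (enum_rank p) * E p (enum_val j).
Proof.
rewrite !mxE (reindex _ (onW_bij _ (enum_rank_bij I))).
by apply: eq_bigr => p _; rewrite !mxE enum_rankK.
Qed.

(** The orbit of [v] spans the module. Quantifying over arbitrary subspaces [W] lets containment in
    a span be tested on the orbit. *)
Definition generates (F : fieldType) (gT : finGroupType) (G : {group gT}) d
    (rG : mx_representation F G d) (v : 'rV[F]_d) : Prop :=
  forall k (W : 'M[F]_(k, d)), (forall g, g \in G -> (v *m rG g <= W)%MS) ->
  forall x : 'rV_d, (x <= W)%MS.

(** The vectors that [f] sends into [W] form the kernel of [f] followed by the cokernel of [W], a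
    subspace containing the orbit of [v]. *)
Lemma generates_linear (F : fieldType) (gT : finGroupType) (G : {group gT}) d
    (rG : mx_representation F G d) (v : 'rV[F]_d) (N k : nat)
    (f : 'rV[F]_d -> 'rV[F]_N) (W : 'M[F]_(k, N)) :
    generates rG v -> linear f -> (forall g, g \in G -> (f (v *m rG g) <= W)%MS) ->
  forall x, (f x <= W)%MS.
Proof.
move=> gen_v lin_f fvW x.
pose fL : {linear 'rV[F]_d -> 'rV[F]_N} := HB.pack f (GRing.isLinear.Build _ _ _ _ f lin_f).
have fE y : f y = y *m lin1_mx fL by rewrite mul_rV_lin1.
have kerP y : (y <= kermx (lin1_mx fL *m cokermx W))%MS = (f y <= W)%MS.
  by rewrite fE [RHS]submxE -mulmxA; apply/sub_kermxP/eqP.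
by rewrite -kerP; apply: gen_v => g Gg; rewrite kerP fvW.
Qed.

Lemma submx_delta (F : fieldType) d k (W : 'M[F]_(k, d)) :
  (forall j, (delta_mx 0 j : 'rV_d) <= W)%MS -> forall x : 'rV_d, (x <= W)%MS.
Proof.
move=> dW x; rewrite [x]row_sum_delta summx_sub // => j _.
exact: scalemx_sub.
Qed.

Section Specht.

Variables (r : nat) (mu : seq nat).

Definition specht_gen : 'rV[rat]_(\rank (specht_mx r mu)) :=
  in_submod (specht_mx r mu) (polytabloid mu 1%g).

Lemma polytabloid_specht (t : 'S_r) : (polytabloid mu t <= specht_mx r mu)%MS.
Proof. by rewrite /specht_mx (sumsmx_sup t) // genmxE. Qed.

Lemma specht_genM (s : 'S_r) :
  specht_gen *m specht r mu s = in_submod (specht_mx r mu) (polytabloid mu s).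
Proof.
rewrite /specht_gen -(in_submodJ (specht_mxmodule r mu)) ?polytabloid_specht //.
by rewrite polytabloidM mul1g.
Qed.

Lemma specht_gen_generates : generates (specht r mu) specht_gen.
Proof.
move=> k W genW x.
have spechtM p (M : 'M_(_, p)) q (W' : 'M_(q, p)) :
    (forall t, polytabloid mu t *m M <= W')%MS -> (specht_mx r mu *m M <= W')%MS.
  move=> polyM; rewrite sumsmxMr_gen; apply/sumsmx_subP=> t _.
  by rewrite genmxE (eqmxMr _ (genmxE _)).
rewrite -[x](val_submodK (U := specht_mx r mu)) in_submodE.
apply: submx_trans (submxMr _ (val_submodP x)) _.
by apply: spechtM => t; rewrite -in_submodE -specht_genM genW ?inE.
Qed.

Lemma specht_gen_relation (c : 'S_r -> rat) :
  \sum_s c s *: polytabloid mu s = 0 -> \sum_s c s *: (specht_gen *m specht r mu s) = 0.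
Proof.
move=> rel; under eq_bigr do rewrite specht_genM in_submodE scalemxAl.
by rewrite -mulmx_suml rel mul0mx.
Qed.

End Specht.

Section Induction.

Variables (F : fieldType) (gT : finGroupType) (H : {group gT}) (d : nat).
Variable rH : mx_representation F H d.

Lemma unit_coset_proof : (H : {set gT}) \in rcosets H [set: gT].
Proof. by apply/rcosetsP; exists 1%g; rewrite ?inE // mulg1. Qed.

Definition unit_coset : right_coset H := Sub (H : {set gT}) unit_coset_proof.

Lemma coset_rep_unit : coset_rep unit_coset = 1%g.
Proof. by rewrite /coset_rep /= /repr group1. Qed.

Definition ind_embed (x : 'rV[F]_d) : 'rV[F]_#|{: right_coset H * 'I_d}| :=
  \row_q (((enum_val q).1 == unit_coset)%:R * x 0 (enum_val q).2).

Lemma ind_embed_linear : linear ind_embed.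
Proof. by move=> a x y; apply/rowP=> q; rewrite !mxE mulrDr mulrCA. Qed.

Lemma ind_embedM x g q :
  (ind_embed x *m ind_repr rH g) 0 (enum_rank q) =
  (let h := (g * (coset_rep q.1)^-1)%g in if h \in H then (x *m rH h) 0 q.2 else 0).
Proof.
rewrite fin_mx_mul enum_rankK /=.
rewrite (eq_bigr (fun p : right_coset H * 'I_d =>
  ((p.1 == unit_coset)%:R * x 0 p.2) * ind_coef rH g (p.1, p.2) q)) => [|[C i] _]; last first.
  by rewrite mxE enum_rankK.
rewrite -(pair_bigA _ (fun C i => ((C == unit_coset)%:R * x 0 i) * ind_coef rH g (C, i) q)) /=.
rewrite (bigD1 unit_coset) //= [X in _ + X]big1 => [|C /negPf->]; last first.
  by rewrite big1 // => i _; rewrite !mul0r.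
rewrite addr0 eqxx /ind_coef /= coset_rep_unit mul1g.
case: ifP => [_|_]; last by rewrite big1 // => i _; rewrite mulr0.
by rewrite mxE; apply: eq_bigr => i _; rewrite mul1r.
Qed.

Lemma ind_embedH x h : h \in H -> ind_embed x *m ind_repr rH h = ind_embed (x *m rH h).
Proof.
move=> Hh; apply/rowP=> q; rewrite -(enum_valK q) ind_embedM /= [RHS]mxE enum_rankK.
rewrite groupMl // groupV.
have -> : (coset_rep (enum_val q).1 \in H) = ((enum_val q).1 == unit_coset).
  by rewrite right_coset_eq coset_rep_unit invg1 mulg1.
by case: eqP => [->|_]; rewrite ?coset_rep_unit ?invg1 ?mulg1 ?mul1r ?mul0r.
Qed.

(** Basis vectors on the coset [C] are translates, by its representative, of basis vectors on the
    unit coset, where generation by [v] applies. *)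
Lemma ind_embed_generates v : generates rH v -> generates (ind_repr rH) (ind_embed v).
Proof.
move=> gen_v k W genW; apply: submx_delta => j.
rewrite -(enum_valK j); case: (enum_val j) => C i.
have -> : delta_mx 0 (enum_rank (C, i)) = ind_embed (delta_mx 0 i) *m ind_repr rH (coset_rep C).
  apply/rowP=> q; rewrite -(enum_valK q) ind_embedM mxE eqxx /= (inj_eq enum_rank_inj).
  case: (enum_val q) => D l /=; rewrite -right_coset_eq xpair_eqE eq_sym.
  case: eqP => [->|//]; rewrite mulgV repr_mx1 mulmx1 mxE eqxx /= eq_sym //.
apply: (generates_linear gen_v (f := fun y => ind_embed y *m ind_repr rH (coset_rep C))).
  by move=> a x y; rewrite ind_embed_linear mulmxDl scalemxAl.
move=> h Hh; rewrite -ind_embedH // -mulmxA -repr_mxM ?inE //.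
by apply: genW; rewrite inE.
Qed.

End Induction.

End Generators.

(** * Pure tensors in the module of the wreath product *)

Section Tensors.

Import GroupScope GRing.Theory Num.Theory.
Local Open Scope ring_scope.

Variables (m n : nat) (m_gt0 : (0 < m)%N) (F : fieldType) (d e : nat).
Variables (rW : mx_representation F [set: 'S_m] d).
Variables (rZ : mx_representation F [set: 'S_n] e).

Definition tensor_coef (x : 'I_n -> 'rV[F]_d) (z : 'rV[F]_e) (p : {ffun 'I_n -> 'I_d} * 'I_e) : F :=
  (\prod_i x i 0 (p.1 i)) * z 0 p.2.

Definition tensor (x : 'I_n -> 'rV[F]_d) (z : 'rV[F]_e) :
    'rV[F]_#|{: {ffun 'I_n -> 'I_d} * 'I_e}| :=
  \row_q tensor_coef x z (enum_val q).

Lemma eq_tensor x y z : x =1 y -> tensor x z = tensor y z.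
Proof. by move=> xy; apply/rowP=> q; rewrite !mxE /tensor_coef; under eq_bigr do rewrite xy. Qed.

Lemma tensor_linear_top x : linear (tensor x).
Proof. by move=> a y z; apply/rowP=> q; rewrite !mxE /tensor_coef !mxE mulrDr mulrCA. Qed.

Lemma tensor_linear_base x j z : linear (fun y => tensor (fun i => if i == j then y else x i) z).
Proof.
have E y q : tensor (fun i => if i == j then y else x i) z 0 q =
    y 0 ((enum_val q).1 j) * tensor_coef (fun i => if i == j then const_mx 1 else x i) z (enum_val q).
  rewrite mxE /tensor_coef mulrA [in LHS](bigD1 j) //= [in RHS](bigD1 j) //= eqxx mxE mul1r.
  congr (_ * _ * _).
  by apply: eq_bigr => i /negPf->.
by move=> a y1 y2; apply/rowP=> q; rewrite E !mxE mulrDl -mulrA -!E !mxE.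
Qed.

Lemma tensorM x z b h :
  tensor x z *m oslash m_gt0 rW rZ (wreath_elt b h) =
  tensor (fun j => x ((h^-1)%g j) *m rW (b ((h^-1)%g j))) (z *m rZ h).
Proof.
apply/rowP=> q; rewrite fin_mx_mul mxE /tensor_coef; case: (enum_val q) => g l /=.
rewrite (eq_bigr (fun p : {ffun 'I_n -> 'I_d} * 'I_e =>
    (\prod_i (x i 0 (p.1 i) * rW (b i) (p.1 i) (g (h i)))) *
    (z 0 p.2 * rZ h p.2 l))) => [|[f k] _]; last first.
  rewrite mxE enum_rankK /oslash_coef /= top_wreath_elt big_split /= mulrACA.
  by congr (_ * _ * _); apply: eq_bigr => i _; rewrite base_wreath_elt.
rewrite -(pair_bigA _ (fun (f : {ffun 'I_n -> 'I_d}) k =>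
    (\prod_i (x i 0 (f i) * rW (b i) (f i) (g (h i)))) * (z 0 k * rZ h k l))) /=.
under eq_bigr do rewrite -mulr_sumr.
rewrite -mulr_suml; congr (_ * _); last by rewrite mxE.
rewrite (reindex_inj (@perm_inj _ h)) /=.
under [RHS]eq_bigr do rewrite permK mxE.
by rewrite bigA_distr_bigA.
Qed.

Lemma tensor_generates w z : generates rW w -> generates rZ z ->
  generates (oslash m_gt0 rW rZ) (tensor (fun=> w) z).
Proof.
move=> gen_w gen_z k W genW; apply: submx_delta => q.
rewrite -(enum_valK q); case: (enum_val q) => f l.
have -> : delta_mx 0 (enum_rank (f, l)) = tensor (fun i => delta_mx 0 (f i)) (delta_mx 0 l).
  apply/rowP=> p; rewrite !mxE eqxx /= -{1}(enum_valK p) (inj_eq enum_rank_inj).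
  case: (enum_val p) => g j; rewrite xpair_eqE -mulnb natrM /tensor_coef /= mxE eqxx; congr (_ * _).
  rewrite (eq_bigr (fun i => (g i == f i)%:R : F)) => [|i _]; last by rewrite mxE eqxx.
  rewrite -natr_prod; congr (_%:R); have [->|neq] := eqVneq g f.
    by rewrite big1 // => i _; rewrite eqxx.
  have [i ni] : exists i, g i != f i.
    apply/existsP; rewrite -negb_forall; apply: contra neq => /forallP h.
    by apply/eqP/ffunP=> i; apply/eqP.
  by rewrite (bigD1 i) //= (negPf ni).
move: (fun i : 'I_n => delta_mx 0 (f i) : 'rV[F]_d) (delta_mx 0 l : 'rV[F]_e) => x y.
apply: (generates_linear gen_z (tensor_linear_top x)) => h _ {y}.
(* Factors are treated one at a time: those from position [c] on are translates of [w], and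
   linearity in a further factor reduces it to translates too. *)
suff main c (xs : 'I_n -> 'rV[F]_d) : (c <= n)%N ->
    (forall i : 'I_n, (c <= i)%N -> exists b, xs i = w *m rW b) ->
    (tensor xs (z *m rZ h) <= W)%MS.
  by apply: (main n) => // i; rewrite leqNgt ltn_ord.
elim: c xs => [|c IHc] xs lecn xsP.
  have [b bP] : exists b : {ffun 'I_n -> 'S_m}, forall i, xs i = w *m rW (b i).
    have ex i : exists b, xs i == w *m rW b by have [//|b ->] := xsP i; exists b.
    by exists [ffun i => xchoose (ex i)] => i; rewrite ffunE; apply/eqP/(xchooseP (ex i)).
  (* The factor arriving at [i] comes from the position that [h] sends to [i], so the base component
     is precomposed with [h]. *)
  have := genW _ (wreath_elt_in (fun j => b (h j)) h); rewrite tensorM.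
  by congr (is_true (_ <= W)%MS); apply: eq_tensor => i; rewrite bP permKV.
pose j := Ordinal lecn.
have -> : tensor xs (z *m rZ h) = tensor (fun i => if i == j then xs j else xs i) (z *m rZ h).
  by apply: eq_tensor => i; case: eqP => [->|].
apply: (generates_linear gen_w (tensor_linear_base xs j (z *m rZ h))) => b _.
apply: IHc => [|i ci]; first exact: ltnW.
case: eqP => [_|/eqP neq]; first by exists b.
by apply: xsP; rewrite ltn_neqAle ci andbT; apply: contra neq => /eqP ij; apply/eqP/val_inj.
Qed.

Lemma tensor_base_elt w z j s :
  tensor (fun=> w) z *m oslash m_gt0 rW rZ (base_elt j s) =
  tensor (fun i => if i == j then w *m rW s else w) z.
Proof.
rewrite tensorM repr_mx1 mulmx1; apply: eq_tensor => i; rewrite invg1 perm1.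
by case: ifP => // _; rewrite repr_mx1 mulmx1.
Qed.

Lemma tensor_top_elt w z h :
  tensor (fun=> w) z *m oslash m_gt0 rW rZ (top_elt m h) = tensor (fun=> w) (z *m rZ h).
Proof. by rewrite tensorM; apply: eq_tensor => i; rewrite repr_mx1 mulmx1. Qed.

Lemma linear_relation (I : finType) N (f : 'rV[F]_d -> 'rV[F]_N) (c : I -> F) v :
  linear f -> \sum_i c i *: v i = 0 -> \sum_i c i *: f (v i) = 0.
Proof.
move=> lin_f rel.
pose fL : {linear 'rV[F]_d -> 'rV[F]_N} := HB.pack f (GRing.isLinear.Build _ _ _ _ f lin_f).
transitivity (fL (\sum_i c i *: v i)); last by rewrite rel linear0.
by rewrite linear_sum; apply: eq_bigr => i _; rewrite linearZ.
Qed.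

End Tensors.

(** * Signed sums over labellings, and the Hom space *)

Section SignedSums.

Import GroupScope GRing.Theory Num.Theory.
Local Open Scope ring_scope.

Variables (r N : nat) (rV : mx_representation rat [set: 'S_r] N) (E : 'rV[rat]_N).

Section Labelling.

Variables (T : finType) (c : {ffun 'I_r -> T}).

Definition signed_sum (a : {ffun 'I_r -> T}) : 'rV[rat]_N :=
  \sum_(g : 'S_r | fperm c g == a) (-1) ^+ odd_perm g *: (E *m rV g).

Lemma fpermM (a : {ffun 'I_r -> T}) s t : fperm (fperm a s) t = fperm a (t * s)%g.
Proof. by apply/ffunP=> k; rewrite !ffunE permM. Qed.

Lemma fperm_inj s : injective (fun a : {ffun 'I_r -> T} => fperm a s).
Proof.
move=> a b /ffunP ab; apply/ffunP=> k.
by have := ab ((s^-1)%g k); rewrite !ffunE permKV.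
Qed.

Lemma signed_sum_fperm a s : signed_sum (fperm a s) =
  (-1) ^+ odd_perm s *: \sum_(g : 'S_r | fperm c g == a) (-1) ^+ odd_perm g *: (E *m rV s *m rV g).
Proof.
rewrite /signed_sum scaler_sumr (reindex_inj (mulgI s)) /=; apply: eq_big => [g|g _].
  by rewrite -fpermM (inj_eq (@fperm_inj s)).
by rewrite odd_permM signr_addb scalerA repr_mxM ?inE // mulmxA.
Qed.

(** A substitution moves [phi i] next to [E] at the cost of its sign; the given relation, multiplied
    on the right by [g], then kills the part belonging to each [g]. *)
Lemma signed_sum_relation (I : finType) (phi : I -> 'S_r) (cf : I -> rat) :
    \sum_i cf i *: (E *m rV (phi i)) = 0 ->
  forall a, \sum_i (cf i * (-1) ^+ odd_perm (phi i)) *: signed_sum (fperm a (phi i)) = 0.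
Proof.
move=> rel a.
under eq_bigr do
  rewrite signed_sum_fperm scalerA -mulrA -signr_addb addbb mulr1 scaler_sumr.
rewrite exchange_big big1 //= => g _.
rewrite (eq_bigr (fun i => (-1) ^+ odd_perm g *: (cf i *: (E *m rV (phi i)) *m rV g))) => [|i _].
  by rewrite -scaler_sumr -mulmx_suml rel mul0mx scaler0.
by rewrite !scalerA mulrC -scalerA scalemxAl.
Qed.

Lemma signed_sum_content a : signed_sum a != 0 -> exists g, a = fperm c g.
Proof.
move=> nz; apply/exists_eqP; apply: contraNT nz; rewrite negb_exists => /forallP h.
by rewrite /signed_sum big_pred0 // => g; apply/negbTE; rewrite eq_sym.
Qed.

End Labelling.

Lemma cell_col_lt_size (lambda : seq nat) (k : 'I_r) : (cell_col lambda k < r)%N.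
Proof. by apply: leq_ltn_trans (ltn_ord k); apply: leq_subr. Qed.

Definition col_label (lambda : seq nat) : {ffun 'I_r -> 'I_r} :=
  [ffun k => Ordinal (cell_col_lt_size lambda k)].

Lemma col_labelM lambda g s :
  (fperm (col_label lambda) (g * s)%g == fperm (col_label lambda) g)
  = (s \in col_place_perms r lambda).
Proof.
apply/eqP/col_place_permsP => [/ffunP h k | h].
  by have := h ((g^-1)%g k); rewrite !ffunE permM permKV => /(congr1 val).
by apply/ffunP=> k; rewrite !ffunE permM; apply: val_inj; rewrite /= h.
Qed.

(* A homomorphism out of the Specht module is determined by the image of its *)
(* generating polytabloid, which is antisymmetric under the column           *)
(* stabiliser and hence a combination of signed sums.                        *)
Lemma dim_hom_specht (lambda : seq nat) (k : nat) (U : 'M[rat]_(k, N)) :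
    generates rV E ->
    (forall a, (signed_sum (col_label lambda) a <= U)%MS) ->
  (\dim (hom_space (specht r lambda) rV) <= \rank U)%N.
Proof.
move=> genE sumU; pose u := specht_gen r lambda.
set C := col_place_perms r lambda.
(* [P] antisymmetrises over columns: it turns translates of [E] into signed sums up to sign, and
   multiplies [u *m A] by the order of [C] for each homomorphism [A]. *)
pose P := \sum_(p in C) (-1) ^+ odd_perm p *: rV p.
have PU (x : 'rV_N) : (x *m P <= U)%MS.
  apply: (generates_linear genE (f := fun x => x *m P)) => [a y z|g _].
    by rewrite mulmxDl scalemxAl.
  have -> : E *m rV g *m P =
      (-1) ^+ odd_perm g *: signed_sum (col_label lambda) (fperm (col_label lambda) g).
    rewrite /signed_sum (reindex_inj (mulgI g)) /= /P mulmx_sumr scaler_sumr.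
    apply: eq_big => [p|p _]; first by rewrite col_labelM.
    rewrite odd_permM signr_addb !scalerA mulrA -signr_addb addbb mul1r.
    by rewrite -scalemxAr repr_mxM ?inE // mulmxA.
  exact: scalemx_sub.
pose f : {linear 'M[rat]_(_, N) -> 'rV[rat]_N} := mulmx u.
pose L := linfun f.
(* A homomorphism that kills the generator [u] is zero. *)
have inj : (lker L :&: hom_space (specht r lambda) rV)%VS = 0%VS.
  apply/eqP; rewrite -subv0; apply/subvP=> A; rewrite memv_cap memv0 => /andP[].
  rewrite memv_ker lfunE /= => /eqP uA /hom_spaceP homA; apply/eqP.
  apply/row_matrixP => i; rewrite row0 rowE; apply/sub_kermxP.
  apply: specht_gen_generates => g _; apply/sub_kermxP.
  by rewrite -mulmxA homA ?inE // mulmxA uA mul0mx.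
have := limg_ker_dim L (hom_space (specht r lambda) rV).
rewrite capvC inj dimv0 add0n => <-.
have Crel p : p \in C -> u *m specht r lambda p = (-1) ^+ odd_perm p *: u.
  by move=> Cp; rewrite specht_genM polytabloid_col // linearZ.
have C_gt0 : (#|C|%:R : rat) != 0.
  by rewrite pnatr_eq0 -lt0n; apply/card_gt0P; exists 1%g; apply: (group1 (col_place_group r lambda)).
pose M : {linear 'rV[rat]_(\rank U) -> 'rV[rat]_N} := mulmxr (row_base U).
have sub : (L @: hom_space (specht r lambda) rV <= limg (linfun M))%VS.
  apply/subvP=> _ /memv_imgP[A /hom_spaceP homA ->]; rewrite lfunE /=.
  have /submxP[D ->] : (u *m A <= row_base U)%MS.
    rewrite eq_row_base -[u *m A](scalerK C_gt0) scalemx_sub //.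
    have -> : #|C|%:R *: (u *m A) = u *m A *m P; last exact: PU.
    rewrite /P mulmx_sumr (eq_bigr (fun=> u *m A)) ?sumr_const ?scaler_nat // => p Cp.
    rewrite -scalemxAr -mulmxA -homA ?inE // mulmxA Crel // -scalemxAl scalerA.
    by rewrite -signr_addb addbb scale1r.
  by apply/memv_imgP; exists D; rewrite ?memvf // lfunE.
apply: leq_trans (dimvS sub) _.
have /eqP := limg_ker_dim (linfun M) fullv; rewrite dimvf /dim /= mul1n => /eqP dimM.
by rewrite -[X in (_ <= X)%N]dimM leq_addl.
Qed.

End SignedSums.

(** * Fillings as tableaux, and finiteness of the set counted *)

Section Tableaux.

Variables (m B : nat) (mu : seq nat).
Hypothesis mu_part : is_partition m mu.

(** Letters start at zero and tableau entries at one, hence the successor. *)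
Definition tableau_of (b : {ffun 'I_m -> 'I_B}) : seq (seq nat) :=
  reshape mu [seq (b k : nat).+1 | k <- enum 'I_m].

Lemma flatten_tableau_of b : flatten (tableau_of b) = [seq (b k : nat).+1 | k <- enum 'I_m].
Proof. by rewrite reshapeKr // size_map size_enum_ord (partition_sumn mu_part). Qed.

Lemma shape_tableau_of b : shape (tableau_of b) = mu.
Proof. by rewrite reshapeKl // size_map size_enum_ord (partition_sumn mu_part). Qed.

Lemma tableau_of_inj : injective tableau_of.
Proof.
move=> b c /(congr1 flatten); rewrite !flatten_tableau_of => /eq_in_map bc.
by apply/ffunP=> k; apply/val_inj/succn_inj/bc; rewrite mem_enum.
Qed.

Lemma nth_tableau_of b k : nth 0 (nth [::] (tableau_of b) (cell_row mu k)) (cell_col mu k) = (b k).+1.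
Proof.
have := nth_flatten 0 (tableau_of b) k; rewrite shape_tableau_of => <-.
by rewrite flatten_tableau_of (nth_map k) ?size_enum_ord // nth_ord_enum.
Qed.

Lemma count_tableau_of b x :
  count_mem x (flatten (tableau_of b)) = #|[pred k | (b k).+1 == x]|.
Proof.
rewrite flatten_tableau_of count_map -size_filter cardE; congr size.
by rewrite [RHS]/enum_mem enumT.
Qed.

Lemma tableau_of_conj_ss b : conj_ss_filling mu b -> conj_semistandard mu (tableau_of b).
Proof.
move=> ssb; have bP k l := forallP (forallP ssb k) l.
have sizeT : size (tableau_of b) = size mu by rewrite -(shape_tableau_of b) size_map.
have size_row i : size (nth [::] (tableau_of b) i) = nth 0 mu i.
  by rewrite -nth_shape shape_tableau_of.
apply/and4P; split; first by rewrite shape_tableau_of.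
- apply/allP => s sT; apply/allP => x xs.
  have : x \in flatten (tableau_of b) by apply/flattenP; exists s.
  by rewrite flatten_tableau_of => /mapP[k _ ->].
- apply/(all_nthP [::]) => i; rewrite sizeT => im; apply/(sortedP 0) => j.
  rewrite size_row => ij.
  have [k [ki kj]] := cell_exists mu_part (ltnW ij).
  have [l [li lj]] := cell_exists mu_part ij.
  have := bP k l; rewrite ki kj li lj !eqxx /= andbC => /andP[kl _].
  have := nth_tableau_of b k; have := nth_tableau_of b l.
  by rewrite ki kj li lj => -> ->; rewrite ltnS.
apply/(sortedP [::]) => i; rewrite sizeT => im; apply/(all_nthP (0, 0)) => j jz.
have := jz; rewrite size_zip !size_row leq_min => /andP[ij i1j].
have [k [ki kj]] := cell_exists mu_part ij.
have [l [li lj]] := cell_exists mu_part i1j.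
have := bP k l; rewrite ki kj li lj !eqxx /= => /andP[kl _].
have := nth_tableau_of b k; have := nth_tableau_of b l.
by rewrite nth_zip_cond jz /= ki kj li lj => -> ->; rewrite ltnS.
Qed.

End Tableaux.

Definition words (T : eqType) (A : seq T) (c : nat) : seq (seq T) :=
  iter c (fun L => [seq x :: s | x <- A, s <- L]) [:: [::]].

Lemma mem_words (T : eqType) (A : seq T) s : all (mem A) s -> s \in words A (size s).
Proof.
elim: s => [|x s IHs] //= /andP[xA sA]; apply/allpairsP; exists (x, s).
by split => //; apply: IHs.
Qed.

Lemma max_mem (w : seq nat) x : x \in w -> x <= \max_(y <- w) y.
Proof. by move=> xw; rewrite (big_rem x) //= leq_maxl. Qed.

(** The type fixes the weight, whose length [M] bounds every entry; all tableaux then lie in the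
    finite set [K], and a tuple is a word in subsets of [K]. *)
Lemma finite_family_tuples mu kappa lambda :
  finite_set [set` [pred Ts | is_family_tuple mu kappa Ts & has_type lambda Ts]].
Proof.
pose M := size (conj_part lambda).
pose K : {fset seq (seq nat)} :=
  [fset x in [seq reshape mu w | w <- words (iota 0 M.+1) (sumn mu)]]%fset.
apply: (@sub_finite_set _ _ [set` words (enum_fset (fpowerset K)) (size kappa)]);
  last exact: finite_seq.
move=> Ts /= /andP[/andP[/eqP sizes ss] /andP[/and3P[gs gp _] /eqP type]].
rewrite -sizes size_map; apply: mem_words; apply/allP => Tf TfTs; rewrite inE /=.
rewrite fpowersetE; apply/fsubsetP => T TTf; rewrite in_fset /=.
have /and4P[/eqP shT _ _ _] := allP (allP ss _ TfTs) _ TTf.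
apply/mapP; exists (flatten T); last by rewrite -shT flattenK.
rewrite -shT -size_flatten; apply: mem_words; apply/allP => x xT.
change (x \in iota 0 M.+1); rewrite mem_iota /= add0n ltnS.
have entry : x \in tuple_entries Ts.
  apply/flattenP; move/flattenP: xT => [row rowT xrow]; exists row => //.
  apply/flattenP; exists T => //; apply/flattenP; exists (enum_fset Tf) => //.
  exact: map_f.
apply: leq_trans (max_mem entry) _; rewrite /M -type conj_partK //.
by rewrite size_mkseq.
Qed.

(** * Family tuples obtained from labelled tableaux *)

Section FamilyTuple.

Variables (n : nat) (kappa : seq nat) (lab : 'I_n -> nat).
Hypothesis lab_lt : forall i, lab i < size kappa.
Hypothesis lab_card : forall j, j < size kappa -> #|[pred i | lab i == j]| = nth 0 kappa j.

Definition family_tuple (ts : 'I_n -> seq (seq nat)) : seq {fset seq (seq nat)} :=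
  mkseq (fun j => [fset x in [seq ts i | i <- enum 'I_n & lab i == j]]%fset) (size kappa).

Definition inj_on_fibers (T : Type) (ts : 'I_n -> T) :=
  forall i i', lab i = lab i' -> ts i = ts i' -> i = i'.

Lemma uniq_fiber (T : eqType) (ts : 'I_n -> T) j :
  inj_on_fibers ts -> uniq [seq ts i | i <- enum 'I_n & lab i == j].
Proof.
move=> inj; rewrite map_inj_in_uniq; first exact/filter_uniq/enum_uniq.
move=> x y.
by rewrite !mem_filter => /andP[/eqP <- _] /andP[/eqP e _]; apply: inj.
Qed.

Lemma mem_family_tuple ts i : ts i \in nth fset0 (family_tuple ts) (lab i).
Proof.
rewrite nth_mkseq // in_fset /=; apply: map_f.
by rewrite mem_filter eqxx mem_enum.
Qed.

(** Tableaux with the same label are distinct, so each pair of label and tableau occurs at most once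
    and the sets determine the multiset of pairs. *)
Lemma family_tuple_fibers ts ts' :
    inj_on_fibers ts -> inj_on_fibers ts' -> family_tuple ts = family_tuple ts' ->
  forall y, #|[pred i | (lab i, ts i) == y]| = #|[pred i | (lab i, ts' i) == y]|.
Proof.
have half us us' y : inj_on_fibers us -> family_tuple us = family_tuple us' ->
    #|[pred i | (lab i, us i) == y]| <= #|[pred i | (lab i, us' i) == y]|.
  move=> inj eqT; case: (pickP [pred i | (lab i, us i) == y]) => [i /= /eqP iy|/eq_card0 -> //].
  have := mem_family_tuple us i; rewrite eqT nth_mkseq // in_fset => /mapP[i'].
  rewrite mem_filter => /andP[/eqP li' _] ui.
  apply: (@leq_trans 1); last by apply/card_gt0P; exists i'; rewrite inE -iy li' ui.
  rewrite -(card1 i); apply/subset_leq_card/subsetP => x; rewrite !inE -iy => /eqP[lx ux].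
  by apply/eqP/inj.
move=> inj inj' eqT y; apply/eqP; rewrite eqn_leq.
by rewrite !half.
Qed.

(** Distinctness makes each family as large as its fibre of [lab]. The weight lists the column
    lengths of [lambda], so its conjugate is [lambda]. *)
Lemma family_tuple_counted (m : nat) (mu lambda : seq nat) (ts : 'I_n -> seq (seq nat)) :
    is_partition m lambda -> inj_on_fibers ts ->
    (forall i, conj_semistandard mu (ts i)) ->
    (forall x, \sum_i count_mem x (flatten (ts i)) =
       #|[pred k : 'I_m | (cell_col lambda k).+1 == x]|) ->
  is_family_tuple mu kappa (family_tuple ts) && has_type lambda (family_tuple ts).
Proof.
move=> lambda_part inj ss weight.
have cnt x : count_mem x (tuple_entries (family_tuple ts))
             = #|[pred k : 'I_m | (cell_col lambda k).+1 == x]|.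
  pose g T := count_mem x (flatten T).
  have -> (X : seq (seq (seq nat))) : count_mem x (flatten (flatten X)) = \sum_(T <- X) g T.
    by elim: X => [|T X IHX] /=; rewrite ?big_nil // flatten_cat count_cat IHX big_cons.
  rewrite big_flatten big_map big_map -[in iota _ _](subn0 (size kappa)) big_mkord.
  rewrite -weight (partition_big (fun i => Ordinal (lab_lt i)) xpredT) //=.
  apply: eq_bigr => j _; set s := [seq ts i | i <- enum 'I_n & _].
  have ps : perm_eq (enum_fset [fset T in s]%fset) s.
    by apply: uniq_perm (fset_uniq _) (uniq_fiber j inj) _ => T; rewrite in_fset.
  by rewrite (perm_big _ ps) big_map big_filter big_enum_cond.
have lambda_ss := partition_sorted lambda_part.
have wE : tuple_weight (family_tuple ts) = conj_part lambda.
  rewrite /tuple_weight /conj_part; set w := tuple_entries _.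
  have -> : \max_(x <- w) x = head 0 lambda.
    apply/eqP; rewrite eqn_leq; apply/andP; split.
      apply/bigmax_leqP_seq => x xw _; have : 0 < count_mem x w by rewrite -has_count has_pred1.
      rewrite cnt => /card_gt0P[k]; rewrite inE => /eqP <-; rewrite -nth0.
      exact: leq_trans (cell_col_lt lambda_part k) (nth_sorted_geq lambda_ss (leq0n _)).
    case E: (head 0 lambda) => [//|h]; have h0 : h < nth 0 lambda 0 by rewrite nth0 E.
    have [k [_ kh]] := cell_exists lambda_part h0.
    apply: max_mem; rewrite -has_pred1 has_count cnt; apply/card_gt0P; exists k.
    by rewrite inE kh.
  apply/eq_map => j; rewrite cnt -(card_col lambda_part); apply: eq_card => k.
  by rewrite !inE eqSS.
apply/andP; split.
  apply/andP; split; last first.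
    apply/allP => Tf /mapP[j _ ->]; apply/allP => T.
    by rewrite in_fset => /mapP[i _ ->].
  apply/eqP/(@eq_from_nth _ 0) => [|j]; rewrite !size_map size_iota // => jk.
  rewrite -map_comp (nth_map 0) ?size_iota // nth_iota //= add0n card_fseq undup_id ?uniq_fiber //.
  by rewrite size_map -lab_card // cardE; congr size; rewrite [RHS]/enum_mem enumT.
rewrite /has_type /= wE conj_partK //; last exact: partition_gt0 lambda_part.
rewrite eqxx andbT.
by rewrite /is_partition sorted_conj_part conj_part_gt0 eqxx.
Qed.

End FamilyTuple.

(** * Rigidity of fillings with strict rows *)

Lemma conj_ss_row_lt (r B : nat) (mu : seq nat) (b : {ffun 'I_r -> 'I_B}) k l :
    is_partition r mu -> conj_ss_filling mu b ->
    cell_row mu k = cell_row mu l -> cell_col mu k < cell_col mu l -> b k < b l.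
Proof.
move=> mu_part ssb kl lt_kl.
have step x y : cell_row mu x = cell_row mu y -> cell_col mu y = (cell_col mu x).+1 -> b x < b y.
  move=> rxy cxy; have := forallP (forallP ssb x) y.
  by rewrite rxy cxy !eqxx /= => /andP[_].
have [d e] : exists d, cell_col mu l = (cell_col mu k + d).+1.
  by exists (cell_col mu l - (cell_col mu k).+1); rewrite -addSn subnKC.
elim: d l kl e {lt_kl} => [|d IHd] l kl e; first by apply: step; rewrite // e addn0.
have [z [zr zc]] : exists z : 'I_r, cell_row mu z = cell_row mu l
    /\ cell_col mu z = (cell_col mu k + d).+1.
  by apply: cell_exists => //; apply: leq_ltn_trans (cell_col_lt mu_part l); rewrite e addnS.
by apply: ltn_trans (IHd z _ zc) (step z l _ _); rewrite ?zr // e zc addnS.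
Qed.

(** In a strict row the order of entries is the order of columns. Hence [p] maps the cells left of
    [k] onto those left of [p k], and counting them shows that it preserves columns too. *)
Lemma row_strict_determined (r B : nat) (mu : seq nat) (b : {ffun 'I_r -> 'I_B}) (p : 'S_r) :
    is_partition r mu ->
    conj_ss_filling mu b -> conj_ss_filling mu (fperm b p) ->
    (forall k, cell_row mu (p k) = cell_row mu k) ->
  p = 1%g.
Proof.
move=> mu_part ssb ssbp rowp.
have lt_iff (c : {ffun 'I_r -> 'I_B}) k l : conj_ss_filling mu c -> cell_row mu k = cell_row mu l ->
    (c k < c l) = (cell_col mu k < cell_col mu l).
  move=> ssc kl; case: (ltngtP (cell_col mu k) (cell_col mu l)) => h.
  - by rewrite (conj_ss_row_lt mu_part ssc kl h).
  - by apply/negbTE; rewrite -leqNgt; apply/ltnW/(conj_ss_row_lt mu_part ssc (esym kl) h).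
  by rewrite (cell_inj kl h) ltnn.
pose left (k : 'I_r) :=
  [set l : 'I_r | (cell_row mu l == cell_row mu k) && (cell_col mu l < cell_col mu k)].
have card_left k : #|left (p k)| = #|left k|.
  rewrite -[RHS](card_imset _ (@perm_inj _ p)); apply: eq_card => l.
  apply/idP/imsetP => [|[z]]; rewrite inE => /andP[/eqP e1 e2].
    exists ((p^-1)%g l); last by rewrite permKV.
    have e : cell_row mu ((p^-1)%g l) = cell_row mu k by rewrite -[LHS]rowp permKV e1 rowp.
    by rewrite inE e eqxx /= -(lt_iff _ _ _ ssbp e) !ffunE permKV (lt_iff _ _ _ ssb e1).
  have e : cell_row mu (p z) = cell_row mu (p k) by rewrite !rowp.
  move=> ->; rewrite inE e eqxx /= -(lt_iff _ _ _ ssb e).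
  by move: e2; rewrite -(lt_iff _ _ _ ssbp e1) !ffunE.
have sub k l : cell_row mu k = cell_row mu l -> cell_col mu k < cell_col mu l ->
    #|left k| < #|left l|.
  move=> kl lt_kl; apply/proper_card/properP; split.
    by apply/subsetP => z; rewrite !inE kl => /andP[-> /=] /ltn_trans ->.
  by exists k; rewrite !inE ?kl ?eqxx ?ltnn //= lt_kl.
apply/permP => k; rewrite perm1; apply: (cell_inj (rowp k)).
have := card_left k; case: (ltngtP (cell_col mu (p k)) (cell_col mu k)) => // h.
  by have := sub _ _ (rowp k) h => /[swap] ->; rewrite ltnn.
by have := sub _ _ (esym (rowp k)) h => /[swap] ->; rewrite ltnn.
Qed.

(** * Spanning the signed sums and counting *)

Section Main.

Import GroupScope GRing.Theory Num.Theory.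
Local Open Scope ring_scope.

(** On good arguments [f] depends on [D] up to scalars, so one representative for each value in [s]
    suffices. *)
Lemma few_values_span (A : finType) (X : eqType) (N : nat) (D : A -> X)
    (f : A -> 'rV[rat]_N) (good : pred A) (s : seq X) :
    (forall t t', good t -> good t' -> D t = D t' -> (f t <= f t')%MS) ->
  exists2 U : 'M[rat]_N, (\rank U <= size s)%N
    & forall t, good t -> D t \in s -> (f t <= U)%MS.
Proof.
move=> fD; elim: s => [|y s [U rU sU]]; first by exists 0; rewrite ?mxrank0.
case: (pickP [pred t | good t && (D t == y)]) => [t0 /andP[g0 /eqP D0]|none].
  exists (U + <<f t0>>)%MS => [|t gt].
    apply: leq_trans (mxrank_adds_leqif _ _) _; rewrite genmxE /= -[(size s).+1]addn1.
    by rewrite leq_add // rank_leq_row.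
  rewrite inE => /orP[/eqP Dt|Dt]; last exact: submx_trans (sU _ gt Dt) (addsmxSl _ _).
  by apply: submx_trans (addsmxSr _ _); rewrite genmxE; apply: fD; rewrite // D0.
exists U => [|t gt]; first exact: leqW.
rewrite inE => /orP[Dt|]; last exact: sU.
by have := none t; rewrite /= gt Dt.
Qed.

Section InducedGenerator.

Variables (m n : nat) (m_gt0 : (0 < m)%N) (F : fieldType) (d e : nat).
Variables (rW : mx_representation F [set: 'S_m] d) (rZ : mx_representation F [set: 'S_n] e).
Variables (w : 'rV[F]_d) (z : 'rV[F]_e).

Definition induced_gen := ind_embed (wreath_group m n) (tensor (fun _ : 'I_n => w) z).

Lemma induced_base_relation (c : 'S_m -> F) j : \sum_s c s *: (w *m rW s) = 0 ->
  \sum_s c s *: (induced_gen *m ind_repr (oslash m_gt0 rW rZ) (base_elt j s)) = 0.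
Proof.
move=> rel; under eq_bigr do rewrite ind_embedH ?wreath_elt_in //= tensor_base_elt.
apply: (linear_relation (f := fun y => ind_embed _ (tensor (fun i => if i == j then y else w) z))) => //.
by move=> a y1 y2; rewrite (tensor_linear_base (fun=> w)) ind_embed_linear.
Qed.

Lemma induced_top_relation (c : 'S_n -> F) : \sum_h c h *: (z *m rZ h) = 0 ->
  \sum_h c h *: (induced_gen *m ind_repr (oslash m_gt0 rW rZ) (top_elt m h)) = 0.
Proof.
move=> rel; under eq_bigr do rewrite ind_embedH ?wreath_elt_in //= tensor_top_elt.
apply: (linear_relation (f := fun y => ind_embed _ (tensor (fun=> w) y))) => //.
by move=> a y1 y2; rewrite tensor_linear_top ind_embed_linear.
Qed.

End InducedGenerator.

Section Plethysm.

Variables (m n : nat) (mu nu lambda : seq nat).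
Hypotheses (mu_part : is_partition m mu) (nu_part : is_partition n nu).
Hypothesis lambda_part : is_partition (m * n) lambda.

Variables (N : nat) (rV : mx_representation rat [set: 'S_(m * n)] N) (E : 'rV[rat]_N).
Hypothesis E_generates : generates rV E.
Hypothesis E_base : forall (c : 'S_m -> rat) j, \sum_s c s *: polytabloid mu s = 0 ->
  \sum_s c s *: (E *m rV (base_elt j s)) = 0.
Hypothesis E_top : forall c : 'S_n -> rat, \sum_h c h *: polytabloid nu h = 0 ->
  \sum_h c h *: (E *m rV (top_elt m h)) = 0.

Definition plethysm_sum := signed_sum rV E (col_label (m * n) lambda).

Lemma plethysm_base_relation (c : 'S_m -> rat) : \sum_s c s *: polytabloid mu s = 0 ->
  forall t j x,
  \sum_s (c s * (-1) ^+ odd_perm s) *: plethysm_sum (assemble (set_block t j (fperm x s))) = 0.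
Proof.
move=> rel t j x.
have sum0 := signed_sum_relation (col_label (m * n) lambda) (E_base j rel) (assemble (set_block t j x)).
rewrite -[RHS]sum0; apply: eq_bigr => s _.
by rewrite odd_base_elt fperm_base_elt.
Qed.

Lemma plethysm_top_relation (c : 'S_n -> rat) : \sum_h c h *: polytabloid nu h = 0 ->
  forall t, \sum_h (c h * (-1) ^+ (odd m && odd_perm h)) *: plethysm_sum (assemble (fperm t h)) = 0.
Proof.
move=> rel t.
have sum0 := signed_sum_relation (col_label (m * n) lambda) (E_top rel) (assemble t).
rewrite -[RHS]sum0; apply: eq_bigr => s _.
by rewrite odd_top_elt fperm_top_elt.
Qed.

Definition conj_ss_type := {b : {ffun 'I_m -> 'I_(m * n)} | conj_ss_filling mu b}.

Definition block_sum (t : {ffun 'I_n -> conj_ss_type}) :=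
  plethysm_sum (assemble [ffun i => val (t i)]).

(** [straightening] acts on one block while the others stay fixed; in the induction the blocks from
    position [c] on are already conjugate-semistandard. *)
Lemma block_straightening k (U : 'M[rat]_(k, _)) :
  (forall t, (block_sum t <= U)%MS) -> forall a, (plethysm_sum a <= U)%MS.
Proof.
move=> blockU a; rewrite -(split_blocksK a); move: (split_blocks a) => t {a}.
suff main c (t' : {ffun 'I_n -> {ffun 'I_m -> 'I_(m * n)}}) : (c <= n)%N ->
    (forall i : 'I_n, (c <= i)%N -> conj_ss_filling mu (t' i)) ->
    (plethysm_sum (assemble t') <= U)%MS.
  by apply: (main n) => // i; rewrite leqNgt ltn_ord.
elim: c t' {t} => [|c IHc] t lecn sst.
  have := blockU [ffun i => Sub (t i) (sst i isT)]; rewrite /block_sum.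
  congr (is_true (plethysm_sum (assemble _) <= U)%MS).
  by apply/ffunP => i; rewrite !ffunE.
pose j := Ordinal lecn.
have -> : t = set_block t j (t j) by apply/ffunP => i; rewrite ffunE; case: eqP => [->|].
apply: (straightening mu_part (F := fun x => plethysm_sum (assemble (set_block t j x)))).
  by move=> cf rel x; apply: plethysm_base_relation.
move=> b ssb; apply: IHc => [|i ci]; first exact: ltnW.
rewrite ffunE; case: eqP => // /eqP neq; apply: sst.
by rewrite ltn_neqAle ci andbT; apply: contra neq => /eqP ij; apply/eqP/val_inj.
Qed.

Lemma block_sum_weight t x : block_sum t != 0 ->
  \sum_i count_mem x (flatten (tableau_of mu (val (t i))))
  = #|[pred k : 'I_(m * n) | (cell_col lambda k).+1 == x]|.
Proof.
move=> /signed_sum_content[g tg].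
have -> : #|[pred k : 'I_(m * n) | (cell_col lambda k).+1 == x]|
    = #|[pred z : 'I_m * 'I_n | (val (t z.2) z.1).+1 == x]|.
  pose f (z : 'I_m * 'I_n) := g (mxvec_index z.1 z.2).
  have fi : injective f by move=> [a i] [b j] /perm_inj/mxvec_index_inj[/= -> ->].
  have fE z : (cell_col lambda (f z)) = val (t z.2) z.1.
    have := congr1 (fun a : {ffun 'I_(m * n) -> 'I_(m * n)} => a (mxvec_index z.1 z.2) : nat) tg.
    by rewrite !ffunE blockE offsetE /= => ->.
  rewrite -[RHS](card_imset _ fi); apply: eq_card => k; rewrite inE.
  apply/idP/imsetP => [kx|[z]]; last by rewrite inE => zx ->; rewrite fE.
  exists (block_offset ((g^-1)%g k)); last by rewrite /f mxvec_indexK permKV.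
  by rewrite inE -fE /f mxvec_indexK permKV.
rewrite -sum1_card [RHS]big_mkcond /=.
rewrite (eq_bigr (fun z : 'I_m * 'I_n => ((val (t z.2) z.1).+1 == x) : nat)) => [|z _]; last first.
  by rewrite inE; case: (_ == _).
rewrite -(pair_bigA _ (fun a i => ((val (t i) a).+1 == x) : nat)) exchange_big /=.
apply: eq_bigr => i _; rewrite (count_tableau_of mu_part) -sum1_card [LHS]big_mkcond.
by apply: eq_bigr => a _; rewrite inE; case: (_ == _).
Qed.

(* For even m, block_sum is antisymmetric along the columns of nu; for odd m  *)
(* it satisfies unsigned Garnir relations, hence straightens to strict rows.  *)
Let kappa := if odd m then nu else conj_part nu.
Definition family_index (i : 'I_n) := if odd m then cell_row nu i else cell_col nu i.

Lemma family_index_lt i : (family_index i < size kappa)%N.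
Proof.
rewrite /family_index /kappa; case: ifP => _; first exact: cell_row_lt.
rewrite size_mkseq -nth0; apply: leq_trans (cell_col_lt nu_part i) _.
exact: nth_sorted_geq (partition_sorted nu_part) (leq0n _).
Qed.

Lemma family_index_card j : #|[pred i | family_index i == j]| = nth 0%N kappa j.
Proof.
rewrite /family_index /kappa; case: ifP => _; first exact: card_row.
by rewrite nth_conj_part ?(partition_sorted nu_part) // (card_col nu_part).
Qed.

Definition families (t : {ffun 'I_n -> conj_ss_type}) :=
  family_tuple kappa family_index (fun i => tableau_of mu (val (t i))).

(** Tableaux become letters of an alphabet, totally ordered by their enumeration. *)
Definition letters (t : {ffun 'I_n -> conj_ss_type}) : {ffun 'I_n -> 'I_#|{: conj_ss_type}|} :=
  [ffun i => enum_rank (t i)].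

Definition straight (t : {ffun 'I_n -> conj_ss_type}) :=
  (block_sum t != 0) && (odd m ==> conj_ss_filling nu (letters t)).

Lemma fperm_val (t : {ffun 'I_n -> conj_ss_type}) h :
  fperm [ffun i => val (t i)] h = [ffun i => val (fperm t h i)].
Proof. by apply/ffunP => i; rewrite !ffunE. Qed.

(** For even [m] every block permutation is even, so the relations of [nu] carry over without a
    twist. *)
Lemma block_sum_col_perm t h : ~~ odd m -> h \in col_place_perms n nu ->
  block_sum (fperm t h) = (-1) ^+ odd_perm h *: block_sum t.
Proof.
move=> evm colh.
have := col_place_relation (f := fun=> 1)
  (g := fun h => plethysm_sum (assemble (fperm [ffun i => val (t i)] h))) _ colh.
rewrite scale1r mulr1 !fperm_val => col; rewrite [LHS]col.
  by congr (_ *: plethysm_sum (assemble _)); apply/ffunP => i; rewrite !ffunE perm1.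
move=> c rel; have := plethysm_top_relation rel [ffun i => val (t i)].
by rewrite (negPf evm).
Qed.

(** For odd [m] a strict row of [nu] cannot repeat a letter. For even [m], swapping equal tableaux
    in a column would fix [t] yet negate its nonzero sum. *)
Lemma straight_inj t : straight t ->
  inj_on_fibers family_index (fun i => tableau_of mu (val (t i))).
Proof.
case/andP => nz ss i j lij /(tableau_of_inj mu_part)/val_inj tij; apply/eqP; apply: contraT => neq.
move: ss lij; rewrite /family_index; case: ifP => [oddm /= ss rij|/negbT evm _ cij].
  have [h|h|h] := ltngtP (cell_col nu i) (cell_col nu j);
    last by rewrite (cell_inj rij h) eqxx in neq.
    by have := conj_ss_row_lt nu_part ss rij h; rewrite !ffunE tij ltnn.
  by have := conj_ss_row_lt nu_part ss (esym rij) h; rewrite !ffunE tij ltnn.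
have colh : tperm i j \in col_place_perms n nu.
  by apply/col_place_permsP => z; case: tpermP => [->|->|].
have := block_sum_col_perm t evm colh.
have -> : fperm t (tperm i j) = t.
  by apply/ffunP => z; rewrite ffunE; case: tpermP => [->|->|].
rewrite odd_tperm neq scaleN1r => /eqP; rewrite -addr_eq0 -mulr2n.
by rewrite -scaler_nat scaler_eq0 pnatr_eq0 /= (negPf nz).
Qed.

(** Equal families make [t'] a rearrangement of [t] by a [p] preserving the family index. For odd
    [m] strict rows force [p] to be trivial; for even [m] it permutes within columns of [nu] and
    costs a sign. *)
Lemma straight_families t t' : straight t -> straight t' -> families t = families t' ->
  (block_sum t <= block_sum t')%MS.
Proof.
move=> st st' /(family_tuple_fibers family_index_lt (straight_inj st) (straight_inj st')).
case/perm_of_card_fibers => p pP.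
have tp : t' = fperm t p.
  apply/ffunP => i; rewrite ffunE; apply/val_inj/(tableau_of_inj mu_part).
  by case: (pP i).
have lp i : family_index (p i) = family_index i by case: (pP i).
case/andP: st st' => nz ss /andP[nz' ss']; move: lp ss ss'; rewrite /family_index.
case: (boolP (odd m)) => /= [oddm rowp ss ss'|evm colp _ _].
  have lE : letters t' = fperm (letters t) p by apply/ffunP => i; rewrite tp !ffunE.
  rewrite lE in ss'; rewrite tp (row_strict_determined nu_part ss ss' rowp).
  by rewrite (_ : fperm t 1%g = t) //; apply/ffunP => i; rewrite ffunE perm1.
have colh : p \in col_place_perms n nu by apply/col_place_permsP.
by rewrite tp block_sum_col_perm // eqmx_scale // signr_eq0.
Qed.

(** For odd [m] a block permutation has the sign of [h], which is the twist that [straightening]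
    requires on the diagram of [nu]. *)
Lemma straight_span k (U : 'M[rat]_(k, _)) :
  (forall t, straight t -> (block_sum t <= U)%MS) -> forall t, (block_sum t <= U)%MS.
Proof.
move=> sU t; have [oddm|evm] := boolP (odd m); last first.
  have [->|nz] := eqVneq (block_sum t) 0; first exact: sub0mx.
  by apply: sU; rewrite /straight nz (negPf evm).
pose dec (a : {ffun 'I_n -> 'I_#|{: conj_ss_type}|}) : {ffun 'I_n -> conj_ss_type} :=
  [ffun i => enum_val (a i)].
have -> : t = dec (letters t) by apply/ffunP => i; rewrite !ffunE enum_rankK.
apply: (straightening nu_part (F := fun a => block_sum (dec a))) => [c rel a|a ssa].
  have := plethysm_top_relation rel [ffun i => val (dec a i)].
  rewrite oddm /= => relP; rewrite -[RHS]relP; apply: eq_bigr => h _.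
  rewrite fperm_val; congr (_ *: plethysm_sum (assemble _)).
  by apply/ffunP => i; rewrite !ffunE.
have [->|nz] := eqVneq (block_sum (dec a)) 0; first exact: sub0mx.
apply: sU; rewrite /straight nz oddm /=.
by rewrite (_ : letters _ = a) //; apply/ffunP => i; rewrite !ffunE enum_valK.
Qed.

Lemma dim_hom_plethysm :
  (\dim (hom_space (specht (m * n) lambda) rV) <= family_tuple_count mu kappa lambda)%N.
Proof.
have [U rU sU] := @few_values_span _ _ _ families block_sum straight
  (enum_fset (fset_set [set` [pred Ts | is_family_tuple mu kappa Ts & has_type lambda Ts]]))
  straight_families.
apply: leq_trans rU; apply: (dim_hom_specht E_generates).
apply: block_straightening; apply: straight_span => t st; apply: sU => //.
rewrite in_fset_set ?inE /=; last exact: finite_family_tuples.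
rewrite mem_setE inE /=.
apply: (family_tuple_counted (ts := fun i => tableau_of mu (val (t i))) family_index_lt
  (fun j _ => family_index_card j) lambda_part (straight_inj st)) => [i|x].
  exact: tableau_of_conj_ss (valP (t i)).
by case/andP: st => /block_sum_weight.
Qed.

End Plethysm.

End Main.

Theorem theorem6p1 (m n : nat) (m_gt0 : (0 < m)%N) (n_gt0 : (0 < n)%N)
    (mu nu lambda : seq nat) :
  is_partition m mu -> is_partition n nu -> is_partition (m * n) lambda ->
  let kappa := if odd m then nu else conj_part nu in
  (\dim (hom_space (specht (m * n) lambda)
           (ind_repr (oslash m_gt0 (specht m mu) (specht n nu))))
     <= family_tuple_count mu kappa lambda)%N.
Proof.
move=> mu_part nu_part lambda_part; cbv zeta.
apply: (dim_hom_plethysm mu_part nu_part lambda_part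
         (rV := ind_repr (oslash m_gt0 (specht m mu) (specht n nu)))
         (E := induced_gen m n (specht_gen m mu) (specht_gen n nu))) => [|c j rel|c rel].
- by apply: ind_embed_generates; apply: tensor_generates; apply: specht_gen_generates.
- exact/induced_base_relation/specht_gen_relation.
exact/induced_top_relation/specht_gen_relation.
Qed.
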